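(* Let $a,b,c,d,n$ be (complex) parameters, and for $k\in\mathbb{N}_0$ set $$F(n,k) := \frac{(a)_k\,(n)_{k+d}}{(2n)_{k+c}\,(2n)_{k+b}},\qquad G(n,k) := R(n,k)\,F(n,k),\qquad \mathcal{F}(n) := \sum_{k=0}^{\infty}F(n,k),$$ where $R(n,k)$ is the rational function given in the context. Assume that all the quantities $F(n,k)$, $F(n+1,k)$ and $R(n,k)$ ($k\in\mathbb{N}_0$) are defined, that the series $\mathcal{F}(n)$ and $\mathcal{F}(n+1)$ converge, and that $p_2(n)\neq 0$, where $p_1(n),p_2(n)$ are the polynomials given below. Then $$\mathcal{F}(n) = g_1(n) + g_2(n)\,\mathcal{F}(n+1),\qquad g_1(n) = \frac{-G(n,0)}{p_2(n)},\quad g_2(n) = -\frac{p_1(n)}{p_2(n)},$$ where $p_{1}(n) = -a^2 b c + 2 a^3 b c - a^4 b c + a b^2 c - 3 a^2 b^2 c + 2 a^3 b^2 c + a b^3 c - a^2 b^3 c + a b c^2 - 3 a^2 b c^2 + 2 a^3 b c^2 - b^2 c^2 + 4 a b^2 c^2 - 4 a^2 b^2 c^2 - b^3 c^2 + 2 a b^3 c^2 + a b c^3 - a^2 b c^3 - b^2 c^3 + 2 a b^2 c^3 - b^3 c^3 + a^2 b d - 2 a^3 b d + a^4 b d - a b^2 d + 3 a^2 b^2 d - 2 a^3 b^2 d - a b^3 d + a^2 b^3 d + a^2 c d - 2 a^3 c d + a^4 c d - 2 a b c d + 6 a^2 b c d - 4 a^3 b c d + b^2 c d - 5 a b^2 c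 d + 5 a^2 b^2 c d + b^3 c d - 2 a b^3 c d - a c^2 d + 3 a^2 c^2 d - 2 a^3 c^2 d + b c^2 d - 5 a b c^2 d + 5 a^2 b c^2 d + 2 b^2 c^2 d - 4 a b^2 c^2 d + b^3 c^2 d - a c^3 d + a^2 c^3 d + b c^3 d - 2 a b c^3 d + b^2 c^3 d - a^2 d^2 + 2 a^3 d^2 - a^4 d^2 + a b d^2 - 3 a^2 b d^2 + 2 a^3 b d^2 + a b^2 d^2 - a^2 b^2 d^2 + a c d^2 - 3 a^2 c d^2 + 2 a^3 c d^2 - b c d^2 + 4 a b c d^2 - 4 a^2 b c d^2 - b^2 c d^2 + 2 a b^2 c d^2 + a c^2 d^2 - a^2 c^2 d^2 - b c^2 d^2 + 2 a b c^2 d^2 - b^2 c^2 d^2 - a^2 b n + 2 a^3 b n - a^4 b n + a b^2 n - 3 a^2 b^2 n + 2 a^3 b^2 n + a b^3 n - a^2 b^3 n - a^2 c n + 2 a^3 c n - a^4 c n + 6 a b c n - 18 a^2 b c n + 12 a^3 b c n - 3 b^2 c n + 17 a b^2 c n - 17 a^2 b^2 c n - 3 b^3 c n + 6 a b^3 c n + a c^2 n - 3 a^2 c^2 n + 2 a^3 c^2 n - 3 b c^2 n + 17 a b c^2 n - 17 a^2 b c^2 n - 10 b^2 c^2 n + 20 a b^2 c^2 n - 5 b^3 c^2 n + a c^3 n - a^2 c^3 n - 3 b c^3 n + 6 a b c^3 n - 5 b^2 c^3 n + 2 a^2 d n - 4 a^3 d n + 2 a^4 d n - 6 a b d n + 18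 a^2 b d n - 12 a^3 b d n + 2 b^2 d n - 14 a b^2 d n + 14 a^2 b^2 d n + 2 b^3 d n - 4 a b^3 d n - 6 a c d n + 18 a^2 c d n - 12 a^3 c d n + 6 b c d n - 32 a b c d n + 32 a^2 b c d n + 12 b^2 c d n - 24 a b^2 c d n + 4 b^3 c d n + 2 c^2 d n - 14 a c^2 d n + 14 a^2 c^2 d n + 12 b c^2 d n - 24 a b c^2 d n + 10 b^2 c^2 d n + 2 c^3 d n - 4 a c^3 d n + 4 b c^3 d n + 4 a d^2 n - 12 a^2 d^2 n + 8 a^3 d^2 n - 2 b d^2 n + 12 a b d^2 n - 12 a^2 b d^2 n - 2 b^2 d^2 n + 4 a b^2 d^2 n - 2 c d^2 n + 12 a c d^2 n - 12 a^2 c d^2 n - 8 b c d^2 n + 16 a b c d^2 n - 4 b^2 c d^2 n - 2 c^2 d^2 n + 4 a c^2 d^2 n - 4 b c^2 d^2 n - a^2 n^2 + 2 a^3 n^2 - a^4 n^2 + 5 a b n^2 - 15 a^2 b n^2 + 10 a^3 b n^2 - 2 b^2 n^2 + 13 a b^2 n^2 - 13 a^2 b^2 n^2 - 2 b^3 n^2 + 4 a b^3 n^2 + 5 a c n^2 - 15 a^2 c n^2 + 10 a^3 c n^2 - 9 b c n^2 + 52 a b c n^2 - 52 a^2 b c n^2 - 23 b^2 c n^2 + 46 a b^2 c n^2 - 8 b^3 c n^2 - 2 c^2 n^2 + 13 a c^2 n^2 - 13 a^2 c^2 n^2 - 23 b c^2 n^2 + 46 a b c^2 n^2 - 25 b^2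 c^2 n^2 - 2 c^3 n^2 + 4 a c^3 n^2 - 8 b c^3 n^2 - 8 a d n^2 + 24 a^2 d n^2 - 16 a^3 d n^2 + 8 b d n^2 - 48 a b d n^2 + 48 a^2 b d n^2 + 16 b^2 d n^2 - 32 a b^2 d n^2 + 4 b^3 d n^2 + 8 c d n^2 - 48 a c d n^2 + 48 a^2 c d n^2 + 40 b c d n^2 - 80 a b c d n^2 + 28 b^2 c d n^2 + 16 c^2 d n^2 - 32 a c^2 d n^2 + 28 b c^2 d n^2 + 4 c^3 d n^2 - 4 d^2 n^2 + 24 a d^2 n^2 - 24 a^2 d^2 n^2 - 12 b d^2 n^2 + 24 a b d^2 n^2 - 4 b^2 d^2 n^2 - 12 c d^2 n^2 + 24 a c d^2 n^2 - 16 b c d^2 n^2 - 4 c^2 d^2 n^2 + 4 a n^3 - 12 a^2 n^3 + 8 a^3 n^3 - 6 b n^3 + 36 a b n^3 - 36 a^2 b n^3 - 14 b^2 n^3 + 28 a b^2 n^3 - 4 b^3 n^3 - 6 c n^3 + 36 a c n^3 - 36 a^2 c n^3 - 48 b c n^3 + 96 a b c n^3 - 40 b^2 c n^3 - 14 c^2 n^3 + 28 a c^2 n^3 - 40 b c^2 n^3 - 4 c^3 n^3 + 8 d n^3 - 48 a d n^3 + 48 a^2 d n^3 + 40 b d n^3 - 80 a b d n^3 + 24 b^2 d n^3 + 40 c d n^3 - 80 a c d n^3 + 64 b c d n^3 + 24 c^2 d n^3 - 16 d^2 n^3 + 32 a d^2 n^3 - 16 b d^2 n^3 - 16 c d^2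 n^3 - 4 n^4 + 24 a n^4 - 24 a^2 n^4 - 28 b n^4 + 56 a b n^4 - 20 b^2 n^4 - 28 c n^4 + 56 a c n^4 - 64 b c n^4 - 20 c^2 n^4 + 32 d n^4 - 64 a d n^4 + 48 b d n^4 + 48 c d n^4 - 16 d^2 n^4 - 16 n^5 + 32 a n^5 - 32 b n^5 - 32 c n^5 + 32 d n^5 - 16 n^6$, $p_{2}(n) = -4 a n + 4 a^3 n + 4 b n - 12 a^2 b n + 12 a b^2 n - 4 b^3 n + 4 c n - 12 a^2 c n + 24 a b c n - 12 b^2 c n + 12 a c^2 n - 12 b c^2 n - 4 c^3 n - 4 d n + 12 a^2 d n - 24 a b d n + 12 b^2 d n - 24 a c d n + 24 b c d n + 12 c^2 d n + 12 a d^2 n - 12 b d^2 n - 12 c d^2 n + 4 d^3 n + 12 n^2 - 16 a n^2 - 36 a^2 n^2 + 16 a^3 n^2 + 16 b n^2 + 72 a b n^2 - 48 a^2 b n^2 - 36 b^2 n^2 + 48 a b^2 n^2 - 16 b^3 n^2 + 16 c n^2 + 72 a c n^2 - 48 a^2 c n^2 - 72 b c n^2 + 96 a b c n^2 - 48 b^2 c n^2 - 36 c^2 n^2 + 48 a c^2 n^2 - 48 b c^2 n^2 - 16 c^3 n^2 - 16 d n^2 - 72 a d n^2 + 48 a^2 d n^2 + 72 b d n^2 - 96 a b d n^2 + 48 b^2 d n^2 + 72 c d n^2 - 96 a c d n^2 + 96 b c d n^2 + 48 c^2 d n^2 - 36 d^2 n^2 + 48 a d^2 n^2 - 48 b d^2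 n^2 - 48 c d^2 n^2 + 16 d^3 n^2 + 48 n^3 + 92 a n^3 - 144 a^2 n^3 + 16 a^3 n^3 - 92 b n^3 + 288 a b n^3 - 48 a^2 b n^3 - 144 b^2 n^3 + 48 a b^2 n^3 - 16 b^3 n^3 - 92 c n^3 + 288 a c n^3 - 48 a^2 c n^3 - 288 b c n^3 + 96 a b c n^3 - 48 b^2 c n^3 - 144 c^2 n^3 + 48 a c^2 n^3 - 48 b c^2 n^3 - 16 c^3 n^3 + 92 d n^3 - 288 a d n^3 + 48 a^2 d n^3 + 288 b d n^3 - 96 a b d n^3 + 48 b^2 d n^3 + 288 c d n^3 - 96 a c d n^3 + 96 b c d n^3 + 48 c^2 d n^3 - 144 d^2 n^3 + 48 a d^2 n^3 - 48 b d^2 n^3 - 48 c d^2 n^3 + 16 d^3 n^3 - 60 n^4 + 432 a n^4 - 144 a^2 n^4 - 432 b n^4 + 288 a b n^4 - 144 b^2 n^4 - 432 c n^4 + 288 a c n^4 - 288 b c n^4 - 144 c^2 n^4 + 432 d n^4 - 288 a d n^4 + 288 b d n^4 + 288 c d n^4 - 144 d^2 n^4 - 432 n^5 + 432 a n^5 - 432 b n^5 - 432 c n^5 + 432 d n^5 - 432 n^6$.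
   Context: The Pochhammer symbol is $(\alpha)_x = \Gamma(\alpha+x)/\Gamma(\alpha)$ (the index $x$ need not be an integer); for $x=k\in\mathbb{N}_0$ it is the rising factorial $(\alpha)_k=\alpha(\alpha+1)\cdots(\alpha+k-1)$, with $(\alpha)_0=1$. In $F(n+1,k)$ and $\mathcal{F}(n+1)$ the parameter $n$ is replaced by $n+1$ and $a,b,c,d$ are kept fixed. The rational function $R(n,k)$ is $R(n, k) = \frac{1}{(b+k+2 n) (c+k+2 n)} 4 n (1 + 2 n)^2 \big(a b c - a^3 b c - b^2 c + 3 a^2 b^2 c - 3 a b^3 c + b^4 c - b c^2 + 3 a^2 b c^2 - 6 a b^2 c^2 + 3 b^3 c^2 - 3 a b c^3 + 3 b^2 c^3 + b c^4 - a^2 b d + a^3 b d + a b^2 d - 2 a^2 b^2 d + a b^3 d - a^2 c d + a^3 c d + b c d + a b c d - 5 a^2 b c d + 7 a b^2 c d - 3 b^3 c d + a c^2 d - 2 a^2 c^2 d + 7 a b c^2 d - 5 b^2 c^2 d + a c^3 d - 3 b c^3 d + a^2 d^2 - a^3 d^2 - a b d^2 + 2 a^2 b d^2 - a b^2 d^2 - a c d^2 + 2 a^2 c d^2 - 4 a b c d^2 + 2 b^2 c d^2 - a c^2 d^2 + 2 b c^2 d^2 + a b k - a^2 b k - b^2 k + a b^2 k + a^2 b^2 k - 2 a b^3 k + b^4 k + a c k - a^2 c k - 2 b c k + a b c k + 4 a^2 b c k - 8 a b^2 c k + 4 b^3 c k - c^2 k + a c^2 k + a^2 c^2 k - 8 a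 b c^2 k + 7 b^2 c^2 k - 2 a c^3 k + 4 b c^3 k + c^4 k + b d k - a b d k - 2 a^2 b d k + b^2 d k + 4 a b^2 d k - 2 b^3 d k + c d k - a c d k - 2 a^2 c d k + b c d k + 10 a b c d k - 8 b^2 c d k + c^2 d k + 4 a c^2 d k - 8 b c^2 d k - 2 c^3 d k + a^2 d^2 k - b d^2 k - 2 a b d^2 k + b^2 d^2 k - c d^2 k - 2 a c d^2 k + 4 b c d^2 k + c^2 d^2 k + a k^2 - a^2 k^2 - b k^2 + 2 a^2 b k^2 + b^2 k^2 - 4 a b^2 k^2 + 2 b^3 k^2 - c k^2 + 2 a^2 c k^2 + b c k^2 - 7 a b c k^2 + 5 b^2 c k^2 + c^2 k^2 - 4 a c^2 k^2 + 5 b c^2 k^2 + 2 c^3 k^2 + d k^2 - a d k^2 - a^2 d k^2 + 5 a b d k^2 - 4 b^2 d k^2 + 5 a c d k^2 - 7 b c d k^2 - 4 c^2 d k^2 - d^2 k^2 - a d^2 k^2 + 2 b d^2 k^2 + 2 c d^2 k^2 - a k^3 + a^2 k^3 + b k^3 - 2 a b k^3 + b^2 k^3 + c k^3 - 2 a c k^3 + 2 b c k^3 + c^2 k^3 - d k^3 + 2 a d k^3 - 2 b d k^3 - 2 c d k^3 + d^2 k^3 + 2 a b n - a^2 b n - a^3 b n - 2 b^2 n + a b^2 n + 4 a^2 b^2 n - 5 a b^3 n + 2 b^4 n + 2 a c n - a^2 c n - a^3 c n - 7 b c n + a b c n + 19 a^2 b c n - 35 a b^2 c n + 17 b^3 c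 n - 2 c^2 n + a c^2 n + 4 a^2 c^2 n - 35 a b c^2 n + 31 b^2 c^2 n - 5 a c^3 n + 17 b c^3 n + 2 c^4 n - 2 a^2 d n + 2 a^3 d n + 2 b d n + 4 a b d n - 14 a^2 b d n + 18 a b^2 d n - 6 b^3 d n + 2 c d n + 4 a c d n - 14 a^2 c d n + 48 a b c d n - 34 b^2 c d n + 18 a c^2 d n - 34 b c^2 d n - 6 c^3 d n - 4 a d^2 n + 8 a^2 d^2 n - 12 a b d^2 n + 4 b^2 d^2 n - 12 a c d^2 n + 16 b c d^2 n + 4 c^2 d^2 n + 4 a k n - 4 a^2 k n - 7 b k n + 5 a b k n + 10 a^2 b k n + b^2 k n - 24 a b^2 k n + 14 b^3 k n - 7 c k n + 5 a c k n + 10 a^2 c k n + b c k n - 54 a b c k n + 44 b^2 c k n + c^2 k n - 24 a c^2 k n + 44 b c^2 k n + 14 c^3 k n + 4 d k n - 4 a d k n - 6 a^2 d k n + 4 b d k n + 32 a b d k n - 26 b^2 d k n + 4 c d k n + 32 a c d k n - 56 b c d k n - 26 c^2 d k n - 4 d^2 k n - 8 a d^2 k n + 12 b d^2 k n + 12 c d^2 k n - 3 k^2 n - a k^2 n + 7 a^2 k^2 n + 6 b k^2 n - 25 a b k^2 n + 18 b^2 k^2 n + 6 c k^2 n - 25 a c k^2 n + 33 b c k^2 n + 18 c^2 k^2 n - 2 d k^2 n + 18 a d k^2 n - 26 b d k^2 n - 26 c d k^2 n + 8 d^2 k^2 n + 3 k^3 n - 6 a k^3 n + 6 b k^3 n +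 6 c k^3 n - 6 d k^3 n + 4 a n^2 - 3 a^2 n^2 - a^3 n^2 - 10 b n^2 + 5 a b n^2 + 20 a^2 b n^2 - 41 a b^2 n^2 + 22 b^3 n^2 - 10 c n^2 + 5 a c n^2 + 20 a^2 c n^2 - 116 a b c n^2 + 96 b^2 c n^2 - 41 a c^2 n^2 + 96 b c^2 n^2 + 22 c^3 n^2 + 4 d n^2 + 4 a d n^2 - 20 a^2 d n^2 + 72 a b d n^2 - 48 b^2 d n^2 + 72 a c d n^2 - 120 b c d n^2 - 48 c^2 d n^2 - 24 a d^2 n^2 + 24 b d^2 n^2 + 24 c d^2 n^2 - 12 k n^2 + 8 a k n^2 + 17 a^2 k n^2 + 5 b k n^2 - 86 a b k n^2 + 73 b^2 k n^2 + 5 c k n^2 - 86 a c k n^2 + 148 b c k n^2 + 73 c^2 k n^2 + 4 d k n^2 + 56 a d k n^2 - 96 b d k n^2 - 96 c d k n^2 + 24 d^2 k n^2 + 11 k^2 n^2 - 41 a k^2 n^2 + 56 b k^2 n^2 + 56 c k^2 n^2 - 44 d k^2 n^2 + 9 k^3 n^2 - 12 n^3 + 8 a n^3 + 20 a^2 n^3 - 108 a b n^3 + 92 b^2 n^3 - 108 a c n^3 + 216 b c n^3 + 92 c^2 n^3 + 80 a d n^3 - 128 b d n^3 - 128 c d n^3 + 32 d^2 n^3 + 8 k n^3 - 96 a k n^3 + 164 b k n^3 + 164 c k n^3 - 112 d k n^3 + 60 k^2 n^3 - 88 a n^4 + 168 b n^4 + 168 c n^4 - 112 d n^4 + 136 k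 n^4 + 112 n^5\big)$. *)

(* Defs.v *)
From Stdlib Require Import Reals ZArith.
From Coquelicot Require Import Coquelicot.

Open Scope C_scope.

Definition Cexp (z : C) : C :=
  (exp (Re z) * cos (Im z), exp (Re z) * sin (Im z))%R.

Fixpoint rising (alpha : C) (k : nat) : C :=
  match k with
  | O => 1
  | S k' => rising alpha k' * (alpha + INR k')
  end.

(** Gauss' formula  Gamma(z) = lim_m  m! m^z / (z (z+1) ... (z+m)), valid for
    every complex [z] that is not a pole. The value of [Gamma] at a pole is
    meaningless. *)
Definition Gamma_seq (z : C) (m : nat) : C :=
  INR (fact m) * Cexp (z * ln (INR m)) / rising z (S m).

Definition Gamma (z : C) : C :=
  @iota C_CompleteNormedModule 
    (fun l : C => filterlim (Gamma_seq z) eventually (locally l)).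

Definition Gamma_pole (z : C) : Prop := exists m : nat, z = - INR m.

(** (alpha)_x: the rising factorial for x in N_0, and
    Gamma(alpha+x)/Gamma(alpha) for every other complex index. The integer
    part of [Re x] is the only candidate for a natural number equal to [x]. *)
Definition poch (alpha x : C) : C :=
  let k := Z.to_nat (Int_part (Re x)) in
  if Ceq_dec x (INR k) then rising alpha k
  else Gamma (alpha + x) / Gamma alpha.

Definition poch_defined (alpha x : C) : Prop :=
  (exists k : nat, x = INR k) \/
  (~ Gamma_pole alpha /\ ~ Gamma_pole (alpha + x)).

Definition F (a b c d n : C) (k : nat) : C :=
  poch a (INR k) * poch n (INR k + d) /
  (poch (2 * n) (INR k + c) * poch (2 * n) (INR k + b)).

Definition F_defined (a b c d n : C) (k : nat) : Prop :=
  poch_defined a (INR k) /\ poch_defined n (INR k + d) /\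
  poch_defined (2 * n) (INR k + c) /\ poch_defined (2 * n) (INR k + b) /\
  poch (2 * n) (INR k + c) * poch (2 * n) (INR k + b) <> 0.

Definition Rnum (a b c d n k : C) : C :=
  a * b * c - a ^ 3 * b * c - b ^ 2 * c + 3 * a ^ 2 * b ^ 2 * c
  - 3 * a * b ^ 3 * c + b ^ 4 * c - b * c ^ 2 + 3 * a ^ 2 * b * c ^ 2
  - 6 * a * b ^ 2 * c ^ 2 + 3 * b ^ 3 * c ^ 2 - 3 * a * b * c ^ 3
  + 3 * b ^ 2 * c ^ 3 + b * c ^ 4 - a ^ 2 * b * d + a ^ 3 * b * d
  + a * b ^ 2 * d - 2 * a ^ 2 * b ^ 2 * d + a * b ^ 3 * d - a ^ 2 * c * d
  + a ^ 3 * c * d + b * c * d + a * b * c * d - 5 * a ^ 2 * b * c * d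
  + 7 * a * b ^ 2 * c * d - 3 * b ^ 3 * c * d + a * c ^ 2 * d
  - 2 * a ^ 2 * c ^ 2 * d + 7 * a * b * c ^ 2 * d - 5 * b ^ 2 * c ^ 2 * d
  + a * c ^ 3 * d - 3 * b * c ^ 3 * d + a ^ 2 * d ^ 2 - a ^ 3 * d ^ 2
  - a * b * d ^ 2 + 2 * a ^ 2 * b * d ^ 2 - a * b ^ 2 * d ^ 2
  - a * c * d ^ 2 + 2 * a ^ 2 * c * d ^ 2 - 4 * a * b * c * d ^ 2
  + 2 * b ^ 2 * c * d ^ 2 - a * c ^ 2 * d ^ 2 + 2 * b * c ^ 2 * d ^ 2
  + a * b * k - a ^ 2 * b * k - b ^ 2 * k + a * b ^ 2 * k
  + a ^ 2 * b ^ 2 * k - 2 * a * b ^ 3 * k + b ^ 4 * k + a * c * k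
  - a ^ 2 * c * k - 2 * b * c * k + a * b * c * k + 4 * a ^ 2 * b * c * k
  - 8 * a * b ^ 2 * c * k + 4 * b ^ 3 * c * k - c ^ 2 * k + a * c ^ 2 * k
  + a ^ 2 * c ^ 2 * k - 8 * a * b * c ^ 2 * k + 7 * b ^ 2 * c ^ 2 * k
  - 2 * a * c ^ 3 * k + 4 * b * c ^ 3 * k + c ^ 4 * k + b * d * k
  - a * b * d * k - 2 * a ^ 2 * b * d * k + b ^ 2 * d * k
  + 4 * a * b ^ 2 * d * k - 2 * b ^ 3 * d * k + c * d * k - a * c * d * k
  - 2 * a ^ 2 * c * d * k + b * c * d * k + 10 * a * b * c * d * k
  - 8 * b ^ 2 * c * d * k + c ^ 2 * d * k + 4 * a * c ^ 2 * d * k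
  - 8 * b * c ^ 2 * d * k - 2 * c ^ 3 * d * k + a ^ 2 * d ^ 2 * k
  - b * d ^ 2 * k - 2 * a * b * d ^ 2 * k + b ^ 2 * d ^ 2 * k
  - c * d ^ 2 * k - 2 * a * c * d ^ 2 * k + 4 * b * c * d ^ 2 * k
  + c ^ 2 * d ^ 2 * k + a * k ^ 2 - a ^ 2 * k ^ 2 - b * k ^ 2
  + 2 * a ^ 2 * b * k ^ 2 + b ^ 2 * k ^ 2 - 4 * a * b ^ 2 * k ^ 2
  + 2 * b ^ 3 * k ^ 2 - c * k ^ 2 + 2 * a ^ 2 * c * k ^ 2 + b * c * k ^ 2
  - 7 * a * b * c * k ^ 2 + 5 * b ^ 2 * c * k ^ 2 + c ^ 2 * k ^ 2
  - 4 * a * c ^ 2 * k ^ 2 + 5 * b * c ^ 2 * k ^ 2 + 2 * c ^ 3 * k ^ 2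
  + d * k ^ 2 - a * d * k ^ 2 - a ^ 2 * d * k ^ 2 + 5 * a * b * d * k ^ 2
  - 4 * b ^ 2 * d * k ^ 2 + 5 * a * c * d * k ^ 2 - 7 * b * c * d * k ^ 2
  - 4 * c ^ 2 * d * k ^ 2 - d ^ 2 * k ^ 2 - a * d ^ 2 * k ^ 2
  + 2 * b * d ^ 2 * k ^ 2 + 2 * c * d ^ 2 * k ^ 2 - a * k ^ 3
  + a ^ 2 * k ^ 3 + b * k ^ 3 - 2 * a * b * k ^ 3 + b ^ 2 * k ^ 3
  + c * k ^ 3 - 2 * a * c * k ^ 3 + 2 * b * c * k ^ 3 + c ^ 2 * k ^ 3
  - d * k ^ 3 + 2 * a * d * k ^ 3 - 2 * b * d * k ^ 3 - 2 * c * d * k ^ 3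
  + d ^ 2 * k ^ 3 + 2 * a * b * n - a ^ 2 * b * n - a ^ 3 * b * n
  - 2 * b ^ 2 * n + a * b ^ 2 * n + 4 * a ^ 2 * b ^ 2 * n
  - 5 * a * b ^ 3 * n + 2 * b ^ 4 * n + 2 * a * c * n - a ^ 2 * c * n
  - a ^ 3 * c * n - 7 * b * c * n + a * b * c * n + 19 * a ^ 2 * b * c * n
  - 35 * a * b ^ 2 * c * n + 17 * b ^ 3 * c * n - 2 * c ^ 2 * n
  + a * c ^ 2 * n + 4 * a ^ 2 * c ^ 2 * n - 35 * a * b * c ^ 2 * n
  + 31 * b ^ 2 * c ^ 2 * n - 5 * a * c ^ 3 * n + 17 * b * c ^ 3 * n
  + 2 * c ^ 4 * n - 2 * a ^ 2 * d * n + 2 * a ^ 3 * d * n + 2 * b * d * n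
  + 4 * a * b * d * n - 14 * a ^ 2 * b * d * n + 18 * a * b ^ 2 * d * n
  - 6 * b ^ 3 * d * n + 2 * c * d * n + 4 * a * c * d * n
  - 14 * a ^ 2 * c * d * n + 48 * a * b * c * d * n - 34 * b ^ 2 * c * d * n
  + 18 * a * c ^ 2 * d * n - 34 * b * c ^ 2 * d * n - 6 * c ^ 3 * d * n
  - 4 * a * d ^ 2 * n + 8 * a ^ 2 * d ^ 2 * n - 12 * a * b * d ^ 2 * n
  + 4 * b ^ 2 * d ^ 2 * n - 12 * a * c * d ^ 2 * n + 16 * b * c * d ^ 2 * n
  + 4 * c ^ 2 * d ^ 2 * n + 4 * a * k * n - 4 * a ^ 2 * k * n
  - 7 * b * k * n + 5 * a * b * k * n + 10 * a ^ 2 * b * k * n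
  + b ^ 2 * k * n - 24 * a * b ^ 2 * k * n + 14 * b ^ 3 * k * n
  - 7 * c * k * n + 5 * a * c * k * n + 10 * a ^ 2 * c * k * n
  + b * c * k * n - 54 * a * b * c * k * n + 44 * b ^ 2 * c * k * n
  + c ^ 2 * k * n - 24 * a * c ^ 2 * k * n + 44 * b * c ^ 2 * k * n
  + 14 * c ^ 3 * k * n + 4 * d * k * n - 4 * a * d * k * n
  - 6 * a ^ 2 * d * k * n + 4 * b * d * k * n + 32 * a * b * d * k * n
  - 26 * b ^ 2 * d * k * n + 4 * c * d * k * n + 32 * a * c * d * k * n
  - 56 * b * c * d * k * n - 26 * c ^ 2 * d * k * n - 4 * d ^ 2 * k * n
  - 8 * a * d ^ 2 * k * n + 12 * b * d ^ 2 * k * n + 12 * c * d ^ 2 * k * n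
  - 3 * k ^ 2 * n - a * k ^ 2 * n + 7 * a ^ 2 * k ^ 2 * n
  + 6 * b * k ^ 2 * n - 25 * a * b * k ^ 2 * n + 18 * b ^ 2 * k ^ 2 * n
  + 6 * c * k ^ 2 * n - 25 * a * c * k ^ 2 * n + 33 * b * c * k ^ 2 * n
  + 18 * c ^ 2 * k ^ 2 * n - 2 * d * k ^ 2 * n + 18 * a * d * k ^ 2 * n
  - 26 * b * d * k ^ 2 * n - 26 * c * d * k ^ 2 * n + 8 * d ^ 2 * k ^ 2 * n
  + 3 * k ^ 3 * n - 6 * a * k ^ 3 * n + 6 * b * k ^ 3 * n
  + 6 * c * k ^ 3 * n - 6 * d * k ^ 3 * n + 4 * a * n ^ 2
  - 3 * a ^ 2 * n ^ 2 - a ^ 3 * n ^ 2 - 10 * b * n ^ 2 + 5 * a * b * n ^ 2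
  + 20 * a ^ 2 * b * n ^ 2 - 41 * a * b ^ 2 * n ^ 2 + 22 * b ^ 3 * n ^ 2
  - 10 * c * n ^ 2 + 5 * a * c * n ^ 2 + 20 * a ^ 2 * c * n ^ 2
  - 116 * a * b * c * n ^ 2 + 96 * b ^ 2 * c * n ^ 2
  - 41 * a * c ^ 2 * n ^ 2 + 96 * b * c ^ 2 * n ^ 2 + 22 * c ^ 3 * n ^ 2
  + 4 * d * n ^ 2 + 4 * a * d * n ^ 2 - 20 * a ^ 2 * d * n ^ 2
  + 72 * a * b * d * n ^ 2 - 48 * b ^ 2 * d * n ^ 2 + 72 * a * c * d * n ^ 2
  - 120 * b * c * d * n ^ 2 - 48 * c ^ 2 * d * n ^ 2
  - 24 * a * d ^ 2 * n ^ 2 + 24 * b * d ^ 2 * n ^ 2 + 24 * c * d ^ 2 * n ^ 2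
  - 12 * k * n ^ 2 + 8 * a * k * n ^ 2 + 17 * a ^ 2 * k * n ^ 2
  + 5 * b * k * n ^ 2 - 86 * a * b * k * n ^ 2 + 73 * b ^ 2 * k * n ^ 2
  + 5 * c * k * n ^ 2 - 86 * a * c * k * n ^ 2 + 148 * b * c * k * n ^ 2
  + 73 * c ^ 2 * k * n ^ 2 + 4 * d * k * n ^ 2 + 56 * a * d * k * n ^ 2
  - 96 * b * d * k * n ^ 2 - 96 * c * d * k * n ^ 2 + 24 * d ^ 2 * k * n ^ 2
  + 11 * k ^ 2 * n ^ 2 - 41 * a * k ^ 2 * n ^ 2 + 56 * b * k ^ 2 * n ^ 2
  + 56 * c * k ^ 2 * n ^ 2 - 44 * d * k ^ 2 * n ^ 2 + 9 * k ^ 3 * n ^ 2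
  - 12 * n ^ 3 + 8 * a * n ^ 3 + 20 * a ^ 2 * n ^ 3 - 108 * a * b * n ^ 3
  + 92 * b ^ 2 * n ^ 3 - 108 * a * c * n ^ 3 + 216 * b * c * n ^ 3
  + 92 * c ^ 2 * n ^ 3 + 80 * a * d * n ^ 3 - 128 * b * d * n ^ 3
  - 128 * c * d * n ^ 3 + 32 * d ^ 2 * n ^ 3 + 8 * k * n ^ 3
  - 96 * a * k * n ^ 3 + 164 * b * k * n ^ 3 + 164 * c * k * n ^ 3
  - 112 * d * k * n ^ 3 + 60 * k ^ 2 * n ^ 3 - 88 * a * n ^ 4
  + 168 * b * n ^ 4 + 168 * c * n ^ 4 - 112 * d * n ^ 4 + 136 * k * n ^ 4
  + 112 * n ^ 5.

Definition Rden (b c n k : C) : C := (b + k + 2 * n) * (c + k + 2 * n).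

Definition Rfun (a b c d n k : C) : C :=
  1 / Rden b c n k * (4 * n * (1 + 2 * n) ^ 2 * Rnum a b c d n k).

Definition Rfun_defined (b c n k : C) : Prop := Rden b c n k <> 0.

Definition G (a b c d n : C) (k : nat) : C :=
  Rfun a b c d n (INR k) * F a b c d n k.

(** The sum of the series (meaningless when the series diverges). *)
Definition calF (a b c d n : C) : C :=
  @iota C_CompleteNormedModule (fun s : C => is_series (F a b c d n) s).

Definition p1 (a b c d n : C) : C :=
  - a ^ 2 * b * c + 2 * a ^ 3 * b * c - a ^ 4 * b * c + a * b ^ 2 * c
  - 3 * a ^ 2 * b ^ 2 * c + 2 * a ^ 3 * b ^ 2 * c + a * b ^ 3 * c
  - a ^ 2 * b ^ 3 * c + a * b * c ^ 2 - 3 * a ^ 2 * b * c ^ 2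
  + 2 * a ^ 3 * b * c ^ 2 - b ^ 2 * c ^ 2 + 4 * a * b ^ 2 * c ^ 2
  - 4 * a ^ 2 * b ^ 2 * c ^ 2 - b ^ 3 * c ^ 2 + 2 * a * b ^ 3 * c ^ 2
  + a * b * c ^ 3 - a ^ 2 * b * c ^ 3 - b ^ 2 * c ^ 3
  + 2 * a * b ^ 2 * c ^ 3 - b ^ 3 * c ^ 3 + a ^ 2 * b * d
  - 2 * a ^ 3 * b * d + a ^ 4 * b * d - a * b ^ 2 * d
  + 3 * a ^ 2 * b ^ 2 * d - 2 * a ^ 3 * b ^ 2 * d - a * b ^ 3 * d
  + a ^ 2 * b ^ 3 * d + a ^ 2 * c * d - 2 * a ^ 3 * c * d + a ^ 4 * c * d
  - 2 * a * b * c * d + 6 * a ^ 2 * b * c * d - 4 * a ^ 3 * b * c * d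
  + b ^ 2 * c * d - 5 * a * b ^ 2 * c * d + 5 * a ^ 2 * b ^ 2 * c * d
  + b ^ 3 * c * d - 2 * a * b ^ 3 * c * d - a * c ^ 2 * d
  + 3 * a ^ 2 * c ^ 2 * d - 2 * a ^ 3 * c ^ 2 * d + b * c ^ 2 * d
  - 5 * a * b * c ^ 2 * d + 5 * a ^ 2 * b * c ^ 2 * d
  + 2 * b ^ 2 * c ^ 2 * d - 4 * a * b ^ 2 * c ^ 2 * d + b ^ 3 * c ^ 2 * d
  - a * c ^ 3 * d + a ^ 2 * c ^ 3 * d + b * c ^ 3 * d
  - 2 * a * b * c ^ 3 * d + b ^ 2 * c ^ 3 * d - a ^ 2 * d ^ 2
  + 2 * a ^ 3 * d ^ 2 - a ^ 4 * d ^ 2 + a * b * d ^ 2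
  - 3 * a ^ 2 * b * d ^ 2 + 2 * a ^ 3 * b * d ^ 2 + a * b ^ 2 * d ^ 2
  - a ^ 2 * b ^ 2 * d ^ 2 + a * c * d ^ 2 - 3 * a ^ 2 * c * d ^ 2
  + 2 * a ^ 3 * c * d ^ 2 - b * c * d ^ 2 + 4 * a * b * c * d ^ 2
  - 4 * a ^ 2 * b * c * d ^ 2 - b ^ 2 * c * d ^ 2
  + 2 * a * b ^ 2 * c * d ^ 2 + a * c ^ 2 * d ^ 2 - a ^ 2 * c ^ 2 * d ^ 2
  - b * c ^ 2 * d ^ 2 + 2 * a * b * c ^ 2 * d ^ 2 - b ^ 2 * c ^ 2 * d ^ 2
  - a ^ 2 * b * n + 2 * a ^ 3 * b * n - a ^ 4 * b * n + a * b ^ 2 * n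
  - 3 * a ^ 2 * b ^ 2 * n + 2 * a ^ 3 * b ^ 2 * n + a * b ^ 3 * n
  - a ^ 2 * b ^ 3 * n - a ^ 2 * c * n + 2 * a ^ 3 * c * n - a ^ 4 * c * n
  + 6 * a * b * c * n - 18 * a ^ 2 * b * c * n + 12 * a ^ 3 * b * c * n
  - 3 * b ^ 2 * c * n + 17 * a * b ^ 2 * c * n - 17 * a ^ 2 * b ^ 2 * c * n
  - 3 * b ^ 3 * c * n + 6 * a * b ^ 3 * c * n + a * c ^ 2 * n
  - 3 * a ^ 2 * c ^ 2 * n + 2 * a ^ 3 * c ^ 2 * n - 3 * b * c ^ 2 * n
  + 17 * a * b * c ^ 2 * n - 17 * a ^ 2 * b * c ^ 2 * n
  - 10 * b ^ 2 * c ^ 2 * n + 20 * a * b ^ 2 * c ^ 2 * n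
  - 5 * b ^ 3 * c ^ 2 * n + a * c ^ 3 * n - a ^ 2 * c ^ 3 * n
  - 3 * b * c ^ 3 * n + 6 * a * b * c ^ 3 * n - 5 * b ^ 2 * c ^ 3 * n
  + 2 * a ^ 2 * d * n - 4 * a ^ 3 * d * n + 2 * a ^ 4 * d * n
  - 6 * a * b * d * n + 18 * a ^ 2 * b * d * n - 12 * a ^ 3 * b * d * n
  + 2 * b ^ 2 * d * n - 14 * a * b ^ 2 * d * n + 14 * a ^ 2 * b ^ 2 * d * n
  + 2 * b ^ 3 * d * n - 4 * a * b ^ 3 * d * n - 6 * a * c * d * n
  + 18 * a ^ 2 * c * d * n - 12 * a ^ 3 * c * d * n + 6 * b * c * d * n
  - 32 * a * b * c * d * n + 32 * a ^ 2 * b * c * d * n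
  + 12 * b ^ 2 * c * d * n - 24 * a * b ^ 2 * c * d * n
  + 4 * b ^ 3 * c * d * n + 2 * c ^ 2 * d * n - 14 * a * c ^ 2 * d * n
  + 14 * a ^ 2 * c ^ 2 * d * n + 12 * b * c ^ 2 * d * n
  - 24 * a * b * c ^ 2 * d * n + 10 * b ^ 2 * c ^ 2 * d * n
  + 2 * c ^ 3 * d * n - 4 * a * c ^ 3 * d * n + 4 * b * c ^ 3 * d * n
  + 4 * a * d ^ 2 * n - 12 * a ^ 2 * d ^ 2 * n + 8 * a ^ 3 * d ^ 2 * n
  - 2 * b * d ^ 2 * n + 12 * a * b * d ^ 2 * n - 12 * a ^ 2 * b * d ^ 2 * n
  - 2 * b ^ 2 * d ^ 2 * n + 4 * a * b ^ 2 * d ^ 2 * n - 2 * c * d ^ 2 * n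
  + 12 * a * c * d ^ 2 * n - 12 * a ^ 2 * c * d ^ 2 * n
  - 8 * b * c * d ^ 2 * n + 16 * a * b * c * d ^ 2 * n
  - 4 * b ^ 2 * c * d ^ 2 * n - 2 * c ^ 2 * d ^ 2 * n
  + 4 * a * c ^ 2 * d ^ 2 * n - 4 * b * c ^ 2 * d ^ 2 * n - a ^ 2 * n ^ 2
  + 2 * a ^ 3 * n ^ 2 - a ^ 4 * n ^ 2 + 5 * a * b * n ^ 2
  - 15 * a ^ 2 * b * n ^ 2 + 10 * a ^ 3 * b * n ^ 2 - 2 * b ^ 2 * n ^ 2
  + 13 * a * b ^ 2 * n ^ 2 - 13 * a ^ 2 * b ^ 2 * n ^ 2 - 2 * b ^ 3 * n ^ 2
  + 4 * a * b ^ 3 * n ^ 2 + 5 * a * c * n ^ 2 - 15 * a ^ 2 * c * n ^ 2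
  + 10 * a ^ 3 * c * n ^ 2 - 9 * b * c * n ^ 2 + 52 * a * b * c * n ^ 2
  - 52 * a ^ 2 * b * c * n ^ 2 - 23 * b ^ 2 * c * n ^ 2
  + 46 * a * b ^ 2 * c * n ^ 2 - 8 * b ^ 3 * c * n ^ 2 - 2 * c ^ 2 * n ^ 2
  + 13 * a * c ^ 2 * n ^ 2 - 13 * a ^ 2 * c ^ 2 * n ^ 2
  - 23 * b * c ^ 2 * n ^ 2 + 46 * a * b * c ^ 2 * n ^ 2
  - 25 * b ^ 2 * c ^ 2 * n ^ 2 - 2 * c ^ 3 * n ^ 2 + 4 * a * c ^ 3 * n ^ 2
  - 8 * b * c ^ 3 * n ^ 2 - 8 * a * d * n ^ 2 + 24 * a ^ 2 * d * n ^ 2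
  - 16 * a ^ 3 * d * n ^ 2 + 8 * b * d * n ^ 2 - 48 * a * b * d * n ^ 2
  + 48 * a ^ 2 * b * d * n ^ 2 + 16 * b ^ 2 * d * n ^ 2
  - 32 * a * b ^ 2 * d * n ^ 2 + 4 * b ^ 3 * d * n ^ 2 + 8 * c * d * n ^ 2
  - 48 * a * c * d * n ^ 2 + 48 * a ^ 2 * c * d * n ^ 2
  + 40 * b * c * d * n ^ 2 - 80 * a * b * c * d * n ^ 2
  + 28 * b ^ 2 * c * d * n ^ 2 + 16 * c ^ 2 * d * n ^ 2
  - 32 * a * c ^ 2 * d * n ^ 2 + 28 * b * c ^ 2 * d * n ^ 2
  + 4 * c ^ 3 * d * n ^ 2 - 4 * d ^ 2 * n ^ 2 + 24 * a * d ^ 2 * n ^ 2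
  - 24 * a ^ 2 * d ^ 2 * n ^ 2 - 12 * b * d ^ 2 * n ^ 2
  + 24 * a * b * d ^ 2 * n ^ 2 - 4 * b ^ 2 * d ^ 2 * n ^ 2
  - 12 * c * d ^ 2 * n ^ 2 + 24 * a * c * d ^ 2 * n ^ 2
  - 16 * b * c * d ^ 2 * n ^ 2 - 4 * c ^ 2 * d ^ 2 * n ^ 2 + 4 * a * n ^ 3
  - 12 * a ^ 2 * n ^ 3 + 8 * a ^ 3 * n ^ 3 - 6 * b * n ^ 3
  + 36 * a * b * n ^ 3 - 36 * a ^ 2 * b * n ^ 3 - 14 * b ^ 2 * n ^ 3
  + 28 * a * b ^ 2 * n ^ 3 - 4 * b ^ 3 * n ^ 3 - 6 * c * n ^ 3
  + 36 * a * c * n ^ 3 - 36 * a ^ 2 * c * n ^ 3 - 48 * b * c * n ^ 3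
  + 96 * a * b * c * n ^ 3 - 40 * b ^ 2 * c * n ^ 3 - 14 * c ^ 2 * n ^ 3
  + 28 * a * c ^ 2 * n ^ 3 - 40 * b * c ^ 2 * n ^ 3 - 4 * c ^ 3 * n ^ 3
  + 8 * d * n ^ 3 - 48 * a * d * n ^ 3 + 48 * a ^ 2 * d * n ^ 3
  + 40 * b * d * n ^ 3 - 80 * a * b * d * n ^ 3 + 24 * b ^ 2 * d * n ^ 3
  + 40 * c * d * n ^ 3 - 80 * a * c * d * n ^ 3 + 64 * b * c * d * n ^ 3
  + 24 * c ^ 2 * d * n ^ 3 - 16 * d ^ 2 * n ^ 3 + 32 * a * d ^ 2 * n ^ 3
  - 16 * b * d ^ 2 * n ^ 3 - 16 * c * d ^ 2 * n ^ 3 - 4 * n ^ 4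
  + 24 * a * n ^ 4 - 24 * a ^ 2 * n ^ 4 - 28 * b * n ^ 4
  + 56 * a * b * n ^ 4 - 20 * b ^ 2 * n ^ 4 - 28 * c * n ^ 4
  + 56 * a * c * n ^ 4 - 64 * b * c * n ^ 4 - 20 * c ^ 2 * n ^ 4
  + 32 * d * n ^ 4 - 64 * a * d * n ^ 4 + 48 * b * d * n ^ 4
  + 48 * c * d * n ^ 4 - 16 * d ^ 2 * n ^ 4 - 16 * n ^ 5 + 32 * a * n ^ 5
  - 32 * b * n ^ 5 - 32 * c * n ^ 5 + 32 * d * n ^ 5 - 16 * n ^ 6.

Definition p2 (a b c d n : C) : C :=
  - 4 * a * n + 4 * a ^ 3 * n + 4 * b * n - 12 * a ^ 2 * b * n
  + 12 * a * b ^ 2 * n - 4 * b ^ 3 * n + 4 * c * n - 12 * a ^ 2 * c * n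
  + 24 * a * b * c * n - 12 * b ^ 2 * c * n + 12 * a * c ^ 2 * n
  - 12 * b * c ^ 2 * n - 4 * c ^ 3 * n - 4 * d * n + 12 * a ^ 2 * d * n
  - 24 * a * b * d * n + 12 * b ^ 2 * d * n - 24 * a * c * d * n
  + 24 * b * c * d * n + 12 * c ^ 2 * d * n + 12 * a * d ^ 2 * n
  - 12 * b * d ^ 2 * n - 12 * c * d ^ 2 * n + 4 * d ^ 3 * n + 12 * n ^ 2
  - 16 * a * n ^ 2 - 36 * a ^ 2 * n ^ 2 + 16 * a ^ 3 * n ^ 2
  + 16 * b * n ^ 2 + 72 * a * b * n ^ 2 - 48 * a ^ 2 * b * n ^ 2
  - 36 * b ^ 2 * n ^ 2 + 48 * a * b ^ 2 * n ^ 2 - 16 * b ^ 3 * n ^ 2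
  + 16 * c * n ^ 2 + 72 * a * c * n ^ 2 - 48 * a ^ 2 * c * n ^ 2
  - 72 * b * c * n ^ 2 + 96 * a * b * c * n ^ 2 - 48 * b ^ 2 * c * n ^ 2
  - 36 * c ^ 2 * n ^ 2 + 48 * a * c ^ 2 * n ^ 2 - 48 * b * c ^ 2 * n ^ 2
  - 16 * c ^ 3 * n ^ 2 - 16 * d * n ^ 2 - 72 * a * d * n ^ 2
  + 48 * a ^ 2 * d * n ^ 2 + 72 * b * d * n ^ 2 - 96 * a * b * d * n ^ 2
  + 48 * b ^ 2 * d * n ^ 2 + 72 * c * d * n ^ 2 - 96 * a * c * d * n ^ 2
  + 96 * b * c * d * n ^ 2 + 48 * c ^ 2 * d * n ^ 2 - 36 * d ^ 2 * n ^ 2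
  + 48 * a * d ^ 2 * n ^ 2 - 48 * b * d ^ 2 * n ^ 2 - 48 * c * d ^ 2 * n ^ 2
  + 16 * d ^ 3 * n ^ 2 + 48 * n ^ 3 + 92 * a * n ^ 3 - 144 * a ^ 2 * n ^ 3
  + 16 * a ^ 3 * n ^ 3 - 92 * b * n ^ 3 + 288 * a * b * n ^ 3
  - 48 * a ^ 2 * b * n ^ 3 - 144 * b ^ 2 * n ^ 3 + 48 * a * b ^ 2 * n ^ 3
  - 16 * b ^ 3 * n ^ 3 - 92 * c * n ^ 3 + 288 * a * c * n ^ 3
  - 48 * a ^ 2 * c * n ^ 3 - 288 * b * c * n ^ 3 + 96 * a * b * c * n ^ 3
  - 48 * b ^ 2 * c * n ^ 3 - 144 * c ^ 2 * n ^ 3 + 48 * a * c ^ 2 * n ^ 3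
  - 48 * b * c ^ 2 * n ^ 3 - 16 * c ^ 3 * n ^ 3 + 92 * d * n ^ 3
  - 288 * a * d * n ^ 3 + 48 * a ^ 2 * d * n ^ 3 + 288 * b * d * n ^ 3
  - 96 * a * b * d * n ^ 3 + 48 * b ^ 2 * d * n ^ 3 + 288 * c * d * n ^ 3
  - 96 * a * c * d * n ^ 3 + 96 * b * c * d * n ^ 3 + 48 * c ^ 2 * d * n ^ 3
  - 144 * d ^ 2 * n ^ 3 + 48 * a * d ^ 2 * n ^ 3 - 48 * b * d ^ 2 * n ^ 3
  - 48 * c * d ^ 2 * n ^ 3 + 16 * d ^ 3 * n ^ 3 - 60 * n ^ 4
  + 432 * a * n ^ 4 - 144 * a ^ 2 * n ^ 4 - 432 * b * n ^ 4
  + 288 * a * b * n ^ 4 - 144 * b ^ 2 * n ^ 4 - 432 * c * n ^ 4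
  + 288 * a * c * n ^ 4 - 288 * b * c * n ^ 4 - 144 * c ^ 2 * n ^ 4
  + 432 * d * n ^ 4 - 288 * a * d * n ^ 4 + 288 * b * d * n ^ 4
  + 288 * c * d * n ^ 4 - 144 * d ^ 2 * n ^ 4 - 432 * n ^ 5
  + 432 * a * n ^ 5 - 432 * b * n ^ 5 - 432 * c * n ^ 5 + 432 * d * n ^ 5
  - 432 * n ^ 6.

Definition g1 (a b c d n : C) : C := - G a b c d n 0 / p2 a b c d n.

Definition g2 (a b c d n : C) : C := - (p1 a b c d n / p2 a b c d n).

(* Main.v *)
Require Import Defs.
From Stdlib Require Import Reals Lra Lia ZArith.
From Coquelicot Require Import Coquelicot.

(** With e = a + d - b - c - 3 n, the pair (F, G) satisfies the WZ-type relation
    p1(n) F(n+1,k) + p2(n) F(n,k) = G(n,k+1) - G(n,k), and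
    p2(n) = 4 n (1+2n)^2 (e-1) e (e+1). Summing over k, everything reduces to
    G(n,k) -> 0. The relation itself shows that G(n,k) has a limit L. Since
    R(n,k)/k tends to 4 n (1+2n)^2 e (e-1), which is nonzero because p2(n) is,
    k F(n,k) converges to a nonzero multiple of L, and the convergence of the
    series of F(n,k) forces L = 0 by comparison with the harmonic series: no
    asymptotics of the Gamma function are needed. The two shift relations for F
    require Gamma(z+1) = z Gamma(z) and Gamma(z) <> 0, i.e. that Gauss' product
    converges to a nonzero limit; its consecutive ratios are 1 + O(1/m^2). *)

Open Scope C_scope.

(** * Limits and series of complex numbers *)

(** Balls of the uniform structure on [C] are products of real balls, so every limit law below
    reduces to its real counterparts on the two coordinates. *)
Lemma filterlim_C (u : nat -> C) (l : C) :
  filterlim u eventually (locally l) <->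
  is_lim_seq (fun m => Re (u m)) (Re l) /\ is_lim_seq (fun m => Im (u m)) (Im l).
Proof.
  rewrite (filterlim_locally u l), <- !is_lim_seq_spec; simpl.
  split.
  - intros H; split; intros eps; generalize (H eps); apply filter_imp;
      intros m [H1 H2]; assumption.
  - intros [H1 H2] eps; generalize (filter_and _ _ (H1 eps) (H2 eps)).
    apply filter_imp; intros m [K1 K2]; split; assumption.
Qed.

Lemma C_lim_const (c : C) : filterlim (fun _ : nat => c) eventually (locally c).
Proof. apply filterlim_const. Qed.

Lemma C_lim_plus (u v : nat -> C) (l l' : C) :
  filterlim u eventually (locally l) -> filterlim v eventually (locally l') ->
  filterlim (fun m => u m + v m) eventually (locally (l + l')).
Proof.
  rewrite !filterlim_C; intros [Hu Hu'] [Hv Hv']; split;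
    apply is_lim_seq_plus'; assumption.
Qed.

Lemma C_lim_mult (u v : nat -> C) (l l' : C) :
  filterlim u eventually (locally l) -> filterlim v eventually (locally l') ->
  filterlim (fun m => u m * v m) eventually (locally (l * l')).
Proof.
  rewrite !filterlim_C; intros [Hu Hu'] [Hv Hv']; split.
  - apply is_lim_seq_minus'; apply is_lim_seq_mult'; assumption.
  - apply is_lim_seq_plus'; apply is_lim_seq_mult'; assumption.
Qed.

Lemma C_lim_inv (u : nat -> C) (l : C) : l <> 0 ->
  filterlim u eventually (locally l) ->
  filterlim (fun m => / u m) eventually (locally (/ l)).
Proof.
  intros Hl; rewrite !filterlim_C; intros [Hu Hu'].
  assert (Hd : is_lim_seq (fun m => Re (u m) ^ 2 + Im (u m) ^ 2)%R
                 (Re l ^ 2 + Im l ^ 2)%R).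
  { simpl. apply is_lim_seq_plus'; repeat apply is_lim_seq_mult';
      try assumption; apply is_lim_seq_const. }
  assert (Hn : (Re l ^ 2 + Im l ^ 2)%R <> 0%R).
  { rewrite <- Cmod2_alt. apply pow_nonzero. intros H.
    apply Hl, Cmod_eq_0, H. }
  split; apply is_lim_seq_div'; try assumption.
  apply (is_lim_seq_opp _ (Im l)), Hu'.
Qed.

Lemma C_lim_unique (u : nat -> C) (l l' : C) :
  filterlim u eventually (locally l) -> filterlim u eventually (locally l') -> l = l'.
Proof.
  rewrite !filterlim_C; intros [H1 H2] [H3 H4].
  apply is_lim_seq_unique in H1, H2, H3, H4.
  destruct l, l'; simpl in *; congruence.
Qed.

Lemma C_lim_incr_n (u : nat -> C) (k : nat) (l : C) :
  filterlim (fun m => u (m + k)%nat) eventually (locally l) <->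
  filterlim u eventually (locally l).
Proof.
  rewrite !filterlim_C, (is_lim_seq_incr_n (fun m => Re (u m)) k),
    (is_lim_seq_incr_n (fun m => Im (u m)) k).
  reflexivity.
Qed.

Lemma C_lim_inv_INR : filterlim (fun m => / INR (S m)) eventually (locally (RtoC 0)).
Proof.
  assert (H : is_lim_seq (fun m => / INR (S m))%R 0%R).
  { apply (is_lim_seq_incr_1 (fun m => / INR m)%R).
    apply (is_lim_seq_inv INR p_infty); [apply is_lim_seq_INR | discriminate]. }
  apply filterlim_C; split.
  - apply is_lim_seq_ext with (2 := H); intros m.
    rewrite <- RtoC_inv; try reflexivity. apply not_0_INR; lia.
  - apply is_lim_seq_ext with (fun _ => 0%R); [|apply is_lim_seq_const].
    intros m; rewrite <- RtoC_inv; try reflexivity. apply not_0_INR; lia.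
Qed.

Lemma Gamma_lim (z l : C) :
  filterlim (Gamma_seq z) eventually (locally l) -> Gamma z = l.
Proof.
  intros H; unfold Gamma.
  apply (iota_filterlim_locally (V := C_CompleteNormedModule) (Gamma_seq z) l H).
Qed.

Lemma calF_series a b c d n (s : C) : is_series (F a b c d n) s -> calF a b c d n = s.
Proof.
  intros H. apply (iota_filterlim_locally (V := C_CompleteNormedModule) _ s H).
Qed.

Lemma is_series_C (u : nat -> C) (s : C) :
  is_series u s <-> is_series (fun m => Re (u m)) (Re s) /\ is_series (fun m => Im (u m)) (Im s).
Proof.
  assert (HR : forall N, Re (sum_n u N) = sum_n (fun m => Re (u m)) N).
  { induction N; rewrite ?sum_O, ?sum_Sn; [reflexivity|]. rewrite <- IHN; reflexivity. }
  assert (HI : forall N, Im (sum_n u N) = sum_n (fun m => Im (u m)) N).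
  { induction N; rewrite ?sum_O, ?sum_Sn; [reflexivity|]. rewrite <- IHN; reflexivity. }
  change (is_series u s) with (filterlim (sum_n u) eventually (locally s)).
  rewrite filterlim_C; split; intros [H1 H2]; split.
  - exact (is_lim_seq_ext _ _ _ HR H1).
  - exact (is_lim_seq_ext _ _ _ HI H2).
  - apply is_lim_seq_ext with (2 := H1); intros; symmetry; apply HR.
  - apply is_lim_seq_ext with (2 := H2); intros; symmetry; apply HI.
Qed.


(** * Comparison with the harmonic series *)

Lemma ln_succ_le (m : nat) : (0 < m)%nat -> (ln (INR (S m)) - ln (INR m) <= / INR m)%R.
Proof.
  intros Hm. apply lt_0_INR in Hm. rewrite S_INR, <- ln_div; try lra.
  replace ((INR m + 1) / INR m)%R with (1 + / INR m)%R by (field; lra).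
  assert (Hi := Rinv_0_lt_compat _ Hm).
  apply Rle_trans with (ln (exp (/ INR m))); [|rewrite ln_exp; lra].
  apply ln_le; [lra | apply exp_ineq1_le].
Qed.

(** If l > 0, then eventually 1/m <= (2/l) f(m). The increments of ln are at most 1/m, so their
    series would converge too; but its partial sums telescope to ln, which is unbounded. *)
Lemma ex_series_lim_INR_mult_le (f : nat -> R) (l : R) :
  ex_series f -> is_lim_seq (fun m => INR m * f m)%R l -> (l <= 0)%R.
Proof.
  intros Hf Hl. destruct (Rle_lt_dec l 0) as [|Hpos]; [assumption|exfalso].
  apply is_lim_seq_spec in Hl.
  destruct (Hl (mkposreal (l / 2) ltac:(lra))) as [N HN]; simpl in HN.
  (* Starting at [S N] makes the estimate [HN] available for every term and keeps all arguments of
     ln positive. *)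
  set (g m := (ln (INR (S m + S N)) - ln (INR (m + S N)))%R).
  assert (Hg : ex_series g).
  { apply (ex_series_le g (fun m => 2 / l * f (m + S N)%nat)%R).
    - intros m; unfold g.
      assert (H1 := ln_succ_le (m + S N) ltac:(lia)).
      specialize (HN (m + S N)%nat ltac:(lia)). apply Rabs_def2 in HN.
      assert (Hp : (0 < INR (m + S N))%R) by (apply lt_0_INR; lia).
      assert (H2 : (ln (INR (m + S N)) <= ln (INR (S m + S N)))%R)
        by (apply ln_le; [assumption | apply le_INR; lia]).
      change (Rabs (ln (INR (S (m + S N))) - ln (INR (m + S N))) <= 2 / l * f (m + S N)%nat)%R.
      change (S m + S N)%nat with (S (m + S N)) in H2.
      rewrite Rabs_pos_eq by lra. apply Rle_trans with (1 := H1).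
      apply (Rmult_le_reg_l (INR (m + S N) * l / 2)%R); [nra|].
      replace (INR (m + S N) * l / 2 * / INR (m + S N))%R with (l / 2)%R by (field; lra).
      replace (INR (m + S N) * l / 2 * (2 / l * f (m + S N)%nat))%R
        with (INR (m + S N) * f (m + S N)%nat)%R by (field; lra). lra.
    - apply (ex_series_scal (2 / l)%R (fun m => f (m + S N)%nat)).
      apply (ex_series_ext (fun m => f (S N + m)%nat)).
      { intros m; f_equal; lia. }
      apply (ex_series_incr_n f (S N)), Hf. }
  destruct Hg as [s Hs].
  assert (Hsum : forall m, sum_n g m = (ln (INR (S m + S N)) - ln (INR (S N)))%R).
  { induction m; [rewrite sum_O; reflexivity|].
    rewrite sum_Sn, IHm. unfold g, plus; simpl plus. simpl. ring. }
  assert (Hs' : is_lim_seq (fun m => ln (INR (S m + S N)) - ln (INR (S N)))%R (Finite s))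
    by exact (is_lim_seq_ext (sum_n g) _ (Finite s) Hsum Hs).
  assert (Hinf : is_lim_seq (fun m => ln (INR (S m + S N))) p_infty).
  { apply (is_lim_comp_seq ln _ p_infty p_infty).
    - apply is_lim_ln_p.
    - exists 0%nat; discriminate.
    - apply (is_lim_seq_ext (fun m => INR (m + S (S N)))).
      { intros m; f_equal; lia. }
      apply (is_lim_seq_incr_n INR), is_lim_seq_INR. }
  apply (is_lim_seq_plus' _ (fun _ => ln (INR (S N))) _ (ln (INR (S N)))) in Hs';
    [|apply is_lim_seq_const].
  apply (is_lim_seq_ext _ (fun m => ln (INR (S m + S N)))) in Hs'; [|intros; ring].
  apply is_lim_seq_unique in Hs', Hinf. congruence.
Qed.

Lemma ex_series_lim_INR_mult (f : nat -> R) (l : R) :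
  ex_series f -> is_lim_seq (fun m => INR m * f m)%R l -> l = 0%R.
Proof.
  intros Hf Hl. apply Rle_antisym.
  - exact (ex_series_lim_INR_mult_le f l Hf Hl).
  - enough (- l <= 0)%R by lra.
    apply (ex_series_lim_INR_mult_le (fun m => - f m)%R).
    + exact (ex_series_opp f Hf).
    + apply (is_lim_seq_ext (fun m => - (INR m * f m))%R); [intros; ring|].
      apply (is_lim_seq_opp _ l), Hl.
Qed.

Lemma C_ex_series_lim_INR_mult (f : nat -> C) (l : C) :
  ex_series f -> filterlim (fun m => INR m * f m) eventually (locally l) -> l = 0.
Proof.
  intros [s Hs]; rewrite is_series_C in Hs; destruct Hs as [H1 H2].
  rewrite filterlim_C; intros [H3 H4].
  assert (E1 : Re l = 0%R).
  { apply (ex_series_lim_INR_mult (fun m => Re (f m))); [eexists; apply H1|].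
    apply is_lim_seq_ext with (2 := H3); intros m.
    unfold Re, Im; cbn [fst snd Cmult RtoC]; ring. }
  assert (E2 : Im l = 0%R).
  { apply (ex_series_lim_INR_mult (fun m => Im (f m))); [eexists; apply H2|].
    apply is_lim_seq_ext with (2 := H4); intros m.
    unfold Re, Im; cbn [fst snd Cmult RtoC]; ring. }
  destruct l; simpl in *; subst; reflexivity.
Qed.

(** * Gauss' product for the Gamma function *)

Lemma Cmod_le_abs (z : C) : (Cmod z <= Rabs (Re z) + Rabs (Im z))%R.
Proof.
  apply Rsqr_incr_0_var.
  - unfold Rsqr. replace (Cmod z * Cmod z)%R with (Cmod z ^ 2)%R by ring.
    rewrite Cmod2_alt, <- (pow2_abs (Re z)), <- (pow2_abs (Im z)).
    assert (H1 := Rabs_pos (Re z)); assert (H2 := Rabs_pos (Im z)); nra.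
  - assert (H1 := Rabs_pos (Re z)); assert (H2 := Rabs_pos (Im z)); lra.
Qed.

(** The lower bound is 1 + x <= e^x. The same inequality at -x gives e^x (1 - x) <= 1, while (1 + x
    + 2 x^2)(1 - x) = 1 + x^2 (1 - 2 x) >= 1 for x <= 1/2; dividing by 1 - x gives the upper
    bound. *)
Lemma exp_taylor1 (x : R) : (Rabs x <= / 2 -> Rabs (exp x - 1 - x) <= 2 * x ^ 2)%R.
Proof.
  intros Hx. apply Rabs_le_between in Hx.
  assert (H1 := exp_ineq1_le x). assert (H2 := exp_ineq1_le (- x)).
  assert (H3 : (exp x * exp (- x) = 1)%R)
    by (rewrite <- exp_plus, Rplus_opp_r; apply exp_0).
  assert (H4 := exp_pos x).
  rewrite Rabs_pos_eq by lra.
  assert (H5 : (exp x * (1 - x) <= 1)%R) by nra.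
  assert (H6 : (1 <= (1 + x + 2 * x ^ 2) * (1 - x))%R) by nra.
  enough (exp x <= 1 + x + 2 * x ^ 2)%R by lra.
  apply (Rmult_le_reg_r (1 - x)); lra.
Qed.

Lemma Rabs_sin_le (y : R) : (Rabs (sin y) <= Rabs y)%R.
Proof.
  destruct (MVT_gen sin 0 y cos) as [t [_ Ht]].
  - intros x _; apply is_derive_Reals, derivable_pt_lim_sin.
  - intros x _; apply continuity_sin.
  - rewrite sin_0, !Rminus_0_r in Ht. rewrite Ht, Rabs_mult.
    assert (H : (Rabs (cos t) <= 1)%R) by (apply Rabs_le, COS_bound).
    assert (H' := Rabs_pos y); nra.
Qed.

Lemma Rabs_cos_sub_1_le (y : R) : (Rabs (cos y - 1) <= y ^ 2 / 2)%R.
Proof.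
  replace y with (2 * (y / 2))%R at 1 by field.
  rewrite cos_2a_sin.
  assert (H := Rabs_sin_le (y / 2)).
  apply Rsqr_le_abs_1 in H; unfold Rsqr in H.
  rewrite Rabs_minus_sym, Rabs_pos_eq by nra. nra.
Qed.

Lemma sin_taylor1 (y : R) : (Rabs y <= 1 -> Rabs (sin y - y) <= y ^ 2)%R.
Proof.
  intros Hy.
  destruct (MVT_gen (fun x => sin x - x)%R 0 y (fun x => cos x - 1)%R) as [t [Ht1 Ht]].
  - intros x _; auto_derive; [trivial | ring].
  - intros x _. apply continuity_pt_minus; [apply continuity_sin | apply continuity_pt_id].
  - cbv beta in Ht; rewrite sin_0, !Rminus_0_r in Ht. rewrite Ht, Rabs_mult.
    assert (H := Rabs_cos_sub_1_le t).
    assert (Ht2 : (Rabs t <= Rabs y)%R).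
    { revert Ht1; unfold Rmin, Rmax, Rabs.
      destruct (Rle_dec 0 y), (Rcase_abs t), (Rcase_abs y); lra. }
    rewrite <- pow2_abs in H. rewrite <- (pow2_abs y).
    assert (H1 := Rabs_pos t); assert (H2 := Rabs_pos (cos t - 1)); nra.
Qed.

Lemma Cexp_plus (z w : C) : Cexp (z + w) = Cexp z * Cexp w.
Proof.
  destruct z as [x y], w as [x' y']; unfold Cexp; simpl.
  rewrite exp_plus, cos_plus, sin_plus.
  apply injective_projections; simpl; ring.
Qed.

Lemma Cexp_R (x : R) : Cexp x = exp x.
Proof.
  unfold Cexp; simpl. rewrite cos_0, sin_0.
  apply injective_projections; simpl; ring.
Qed.

Lemma Cexp_neq_0 (z : C) : Cexp z <> 0.
Proof.
  intros H. assert (E : Cexp (z + - z) = 1).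
  { rewrite Cplus_opp_r, (Cexp_R 0), exp_0; reflexivity. }
  rewrite Cexp_plus, H, Cmult_0_l in E.
  apply (f_equal Re) in E; simpl in E; lra.
Qed.

(** For w = x + i y, the real part of the error is split as (e^x - 1 - x) cos y + (1 + x)(cos y - 1)
    and the imaginary part as (e^x - 1) sin y + (sin y - y). The four bounds add up to at most 3 x^2
    + (11/4) y^2. *)
Lemma Cexp_taylor1 (w : C) :
  (Cmod w <= / 2 -> Cmod (Cexp w - (1 + w)) <= 3 * Cmod w ^ 2)%R.
Proof.
  intros Hw.
  assert (Hx := Rle_trans _ _ _ (re_le_Cmod w) Hw).
  assert (Hy : (Rabs (Im w) <= / 2)%R).
  { apply Rle_trans with (2 := Hw). apply Rle_trans with (2 := Rmax_Cmod w).
    apply Rmax_r. }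
  rewrite Cmod2_alt. apply Rle_trans with (1 := Cmod_le_abs _).
  destruct w as [x y]; simpl in Hx, Hy |- *. clear Hw.
  assert (E := exp_taylor1 x Hx).
  assert (S := sin_taylor1 y ltac:(lra)).
  assert (K := Rabs_cos_sub_1_le y).
  assert (S1 := Rabs_sin_le y).
  assert (K1 : (Rabs (cos y) <= 1)%R) by (apply Rabs_le, COS_bound).
  assert (E1 : (Rabs (exp x - 1) <= 2 * Rabs x)%R).
  { replace (exp x - 1)%R with ((exp x - 1 - x) + x)%R by ring.
    apply Rle_trans with (1 := Rabs_triang _ _).
    rewrite <- pow2_abs in E. assert (H := Rabs_pos x); nra. }
  replace (exp x * cos y + - (1 + x))%R
    with ((exp x - 1 - x) * cos y + (1 + x) * (cos y - 1))%R by ring.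
  replace (exp x * sin y + - (0 + y))%R
    with ((exp x - 1) * sin y + (sin y - y))%R by ring.
  assert (X := Rabs_triang ((exp x - 1 - x) * cos y) ((1 + x) * (cos y - 1))).
  assert (Y := Rabs_triang ((exp x - 1) * sin y) (sin y - y)).
  rewrite (Rabs_mult (_ - _)), (Rabs_mult (1 + x)) in X.
  rewrite (Rabs_mult (_ - _)) in Y.
  assert (X1 : (Rabs (1 + x) <= 3 / 2)%R).
  { apply Rle_trans with (1 := Rabs_triang _ _). rewrite Rabs_R1; lra. }
  assert (P1 := Rabs_pos (exp x - 1 - x)). assert (P2 := Rabs_pos (cos y - 1)).
  assert (P3 := Rabs_pos (exp x - 1)). assert (P4 := Rabs_pos (sin y)).
  assert (P5 := Rabs_pos x). assert (P6 := Rabs_pos y).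
  assert (Q1 : (Rabs (exp x - 1 - x) * Rabs (cos y) <= 2 * x ^ 2)%R) by nra.
  assert (Q2 : (Rabs (1 + x) * Rabs (cos y - 1) <= 3 / 2 * (y ^ 2 / 2))%R)
    by (apply Rmult_le_compat; try apply Rabs_pos; assumption).
  assert (Q3 : (Rabs (exp x - 1) * Rabs (sin y) <= 2 * Rabs x * Rabs y)%R)
    by (apply Rmult_le_compat; assumption).
  assert (Q4 : (2 * Rabs x * Rabs y <= x ^ 2 + y ^ 2)%R)
    by (assert (H := pow2_ge_0 (Rabs x - Rabs y));
        rewrite <- (pow2_abs x), <- (pow2_abs y); lra).
  assert (H := pow2_ge_0 y); assert (H2 := pow2_ge_0 x); lra.
Qed.

Lemma ln_succ_ge (m : nat) : (0 < m)%nat -> (/ INR (S m) <= ln (INR (S m)) - ln (INR m))%R.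
Proof.
  intros Hm. apply lt_0_INR in Hm. rewrite S_INR.
  assert (H : (ln (INR m) - ln (INR m + 1) <= - / (INR m + 1))%R); [|lra].
  rewrite <- ln_div by lra.
  replace (INR m / (INR m + 1))%R with (1 + - / (INR m + 1))%R by (field; lra).
  rewrite <- (ln_exp (- / (INR m + 1))) at 2.
  apply ln_le; [|apply exp_ineq1_le].
  assert (/ (INR m + 1) < 1)%R; [|lra].
  rewrite <- Rinv_1 at 2. apply Rinv_lt_contravar; lra.
Qed.

(** The relative increments are dominated by a telescoping series. Starting late enough, at M > 4 K,
    the total drift is at most half of |p(M)|, so the increments sum absolutely and the limit stays
    away from 0. *)
Lemma C_lim_of_relative_increments (p : nat -> C) (K : R) (N : nat) :
  (forall m, p m <> 0) -> (0 < N)%nat ->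
  (forall m, (N <= m)%nat ->
     (Cmod (p (S m) - p m) <= K * (/ INR m - / INR (S m)) * Cmod (p m))%R) ->
  exists l : C, l <> 0 /\ filterlim p eventually (locally l).
Proof.
  intros Hp HN Hstep.
  (* The hypothesis at N forces this: a modulus is at most K times a positive number. *)
  assert (HK : (0 <= K)%R).
  { assert (H := Rle_trans _ _ _ (Cmod_ge_0 _) (Hstep N (le_n N))).
    assert (H1 := proj1 (Cmod_gt_0 _) (Hp N)).
    assert (H0 := lt_0_INR N HN).
    assert (H2 : (/ INR (S N) < / INR N)%R).
    { apply Rinv_lt_contravar; [apply Rmult_lt_0_compat|]; rewrite ?S_INR; lra. }
    destruct (Rle_lt_dec 0 K) as [|Hneg]; [assumption|exfalso].
    assert ((K * (/ INR N - / INR (S N)) < 0)%R) by nra. nra. }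
  destruct (INR_unbounded (4 * K)) as [N1 HN1].
  set (M := max N N1).
  assert (HM : (4 * K < INR M)%R).
  { apply Rlt_le_trans with (1 := HN1), le_INR, Nat.le_max_r. }
  assert (HM0 : (0 < INR M)%R) by (apply lt_0_INR; unfold M; lia).
  assert (HMN : (N <= M)%nat) by apply Nat.le_max_l.
  assert (HKM : (K * / INR M <= / 4)%R).
  { apply (Rmult_le_reg_r (INR M)); [assumption|].
    rewrite Rmult_assoc, Rinv_l by lra. lra. }
  set (q j := p (j + M)%nat). set (r j := (/ INR (j + M))%R).
  set (A := Cmod (p M)).
  assert (HA : (0 < A)%R) by apply Cmod_gt_0, Hp.
  assert (Hr : forall j, (0 < r j)%R).
  { intros j; apply Rinv_0_lt_compat, lt_0_INR; lia. }
  assert (Hrdec : forall j, (r (S j) <= r j)%R).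
  { intros j; apply Rinv_le_contravar; [apply lt_0_INR | apply le_INR]; lia. }
  assert (Hq : forall j, (Cmod (q (S j) - q j) <= K * (r j - r (S j)) * Cmod (q j))%R).
  { intros j; apply (Hstep (j + M)%nat); lia. }
  (* The two bounds are proved together: the second gives |q(j)| <= 2 A, which is what the first
     needs to advance, and the first gives the second because K/M <= 1/4. *)
  assert (Hclose : forall j, (Cmod (q j - p M) <= 2 * K * A * (r 0%nat - r j))%R /\
                             (Cmod (q j - p M) <= A / 2)%R).
  { induction j as [|j [IH1 IH2]].
    - change (q 0%nat) with (p M). unfold Cminus; rewrite Cplus_opp_r, Cmod_0. lra.
    - assert (B : (Cmod (q j) <= 2 * A)%R).
      { replace (q j) with ((q j - p M) + p M) by ring.
        assert (T := Cmod_triangle (q j - p M) (p M)). fold A in T. lra. }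
      assert (T := Cmod_triangle (q (S j) - q j) (q j - p M)).
      replace (q (S j) - q j + (q j - p M)) with (q (S j) - p M) in T by ring.
      assert (Q := Hq j). assert (D := Hrdec j).
      assert (Q' : (K * (r j - r (S j)) * Cmod (q j) <= K * (r j - r (S j)) * (2 * A))%R).
      { apply Rmult_le_compat_l; [|assumption]. apply Rmult_le_pos; lra. }
      assert (G1 : (Cmod (q (S j) - p M) <= 2 * K * A * (r 0%nat - r (S j)))%R) by lra.
      split; [assumption|].
      apply Rle_trans with (1 := G1).
      assert (R1 := Hr (S j)). change (r 0%nat) with (/ INR M)%R.
      assert (KA : (0 <= K * A)%R) by (apply Rmult_le_pos; lra).
      assert ((K * A * (/ INR M - r (S j)) <= K * / INR M * A)%R); nra. }
  assert (Hbound : forall j, (A / 2 <= Cmod (q j) <= 2 * A)%R).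
  { intros j; destruct (Hclose j) as [_ H].
    assert (T := Cmod_triangle (q j - p M) (p M)).
    replace (q j - p M + p M) with (q j) in T by ring.
    assert (T' := Cmod_triangle (p M - q j) (q j)).
    replace (p M - q j + q j) with (p M) in T' by ring.
    replace (p M - q j) with (- (q j - p M)) in T' by ring.
    rewrite Cmod_opp in T'. fold A in T, T'. lra. }
  assert (Hser : ex_series (fun j => q (S j) - q j)).
  { apply (ex_series_le (V := C_CompleteNormedModule) _
             (fun j => 2 * K * A * (r j - r (S j)))%R).
    - intros j. change (Cmod (q (S j) - q j) <= 2 * K * A * (r j - r (S j)))%R.
      apply Rle_trans with (1 := Hq j).
      destruct (Hbound j) as [_ B]. assert (D := Hrdec j).
      assert (KD : (0 <= K * (r j - r (S j)))%R) by (apply Rmult_le_pos; lra). nra.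
    - apply (ex_series_scal (2 * K * A)%R (fun j => r j - r (S j))%R).
      exists (r 0%nat - 0)%R.
      apply (is_lim_seq_ext (fun j => r 0%nat - r (S j))%R _ (Finite (r 0%nat - 0)%R)).
      { induction n; [rewrite sum_O; reflexivity|].
        rewrite sum_Sn, <- IHn. unfold plus; simpl plus; simpl. ring. }
      apply is_lim_seq_minus'; [apply is_lim_seq_const|].
      apply (is_lim_seq_ext (fun j => / INR (j + S M))%R).
      { intros j; unfold r; do 2 f_equal; lia. }
      apply (is_lim_seq_incr_n (fun j => / INR j)%R).
      apply (is_lim_seq_inv INR p_infty); [apply is_lim_seq_INR | discriminate]. }
  destruct Hser as [s Hs].
  exists (s + p M).
  assert (Hlim : filterlim p eventually (locally (s + p M))).
  (* [sum_n] includes its last index, so the sum up to j ends at q(j+1) = p(j + 1 + M); hence the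
     shift by [S M]. *)
  { assert (H : filterlim (fun j => p (j + S M)%nat) eventually (locally (s + p M))).
    { apply (filterlim_ext (fun j => sum_n (fun j => q (S j) - q j) j + p M)).
      - induction x.
        + rewrite sum_O. unfold q. replace (1 + M)%nat with (0 + S M)%nat by lia.
          simpl. ring.
        + rewrite sum_Sn. unfold plus; simpl plus.
          replace (p (S x + S M)%nat) with (q (S (S x))) by (unfold q; f_equal; lia).
          replace (p (x + S M)%nat) with (q (S x)) in IHx by (unfold q; f_equal; lia).
          change (sum_n (fun j => q (S j) - q j) x + (q (S (S x)) - q (S x)) + p M
                  = q (S (S x))).
          rewrite <- IHx. ring.
      - apply C_lim_plus; [exact Hs | apply C_lim_const]. }
    exact (proj1 (C_lim_incr_n p (S M) _) H). }
  split; [|assumption].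
  (* A zero limit would make |p(m)|^2 tend to 0, although it is at least (A/2)^2 from M on. *)
  intros Hz; rewrite Hz, filterlim_C in Hlim; destruct Hlim as [H1 H2].
  assert (H0 : is_lim_seq (fun m => Re (p m) * Re (p m) + Im (p m) * Im (p m))%R
                 (0 * 0 + 0 * 0)%R).
  { apply is_lim_seq_plus'; apply is_lim_seq_mult'; assumption. }
  apply (is_lim_seq_incr_n _ M) in H0.
  assert (Hle : Rbar_le ((A / 2) ^ 2)%R (0 * 0 + 0 * 0)%R).
  { apply (is_lim_seq_le _ _ _ _) with (2 := is_lim_seq_const _) (3 := H0).
    intros j; destruct (Hbound j) as [B _].
    apply Rle_trans with (Cmod (q j) ^ 2)%R; [apply pow_incr; lra|].
    rewrite Cmod2_alt; unfold q; simpl; lra. }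
  simpl in Hle. nra.
Qed.

Lemma C_INR_S (k : nat) : RtoC (INR (S k)) = INR k + 1.
Proof. rewrite S_INR; apply RtoC_plus. Qed.

Lemma C_INR_S_neq_0 (k : nat) : RtoC (INR (S k)) <> 0.
Proof. intros H; apply RtoC_inj in H; revert H; apply not_0_INR; lia. Qed.

Lemma Gamma_pole_add (z : C) (k : nat) : Gamma_pole (z + INR k) -> Gamma_pole z.
Proof.
  intros [m Hm]; exists (m + k)%nat. rewrite plus_INR, RtoC_plus.
  replace z with (z + INR k - INR k) by ring. rewrite Hm; ring.
Qed.

Lemma not_Gamma_pole_add_neq_0 (z : C) (k : nat) : ~ Gamma_pole z -> z + INR k <> 0.
Proof.
  intros Hz H; apply Hz; exists k.
  replace z with (z + INR k - INR k) by ring. rewrite H; ring.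
Qed.

Lemma not_Gamma_pole_neq_0 (z : C) : ~ Gamma_pole z -> z <> 0.
Proof.
  intros Hz H; apply (not_Gamma_pole_add_neq_0 z 0 Hz). rewrite H; simpl; ring.
Qed.

Lemma not_Gamma_pole_succ (z : C) : ~ Gamma_pole z -> ~ Gamma_pole (z + 1).
Proof. intros Hz H; apply Hz, (Gamma_pole_add z 1), H. Qed.

Lemma rising_neq_0 (z : C) (k : nat) : ~ Gamma_pole z -> rising z k <> 0.
Proof.
  intros Hz; induction k as [|k IH]; simpl; [apply C1_nz|].
  apply Cmult_neq_0; [assumption | apply not_Gamma_pole_add_neq_0; assumption].
Qed.

Lemma rising_shift (z : C) (k : nat) : z * rising (z + 1) k = rising z (S k).
Proof.
  induction k as [|k IH]; [simpl; ring|].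
  change (z * (rising (z + 1) k * (z + 1 + INR k)) = rising z (S k) * (z + INR (S k))).
  rewrite <- IH, C_INR_S. ring.
Qed.

Lemma rising_pole (m k : nat) : (m < k)%nat -> rising (- INR m) k = 0.
Proof.
  intros H; induction H as [|k H IH]; simpl.
  - ring.
  - rewrite IH; ring.
Qed.

Lemma Gamma_seq_succ (z : C) (m : nat) : ~ Gamma_pole z ->
  Gamma_seq z (S m) = Gamma_seq z m *
    (INR (S m) * Cexp (z * (ln (INR (S m)) - ln (INR m))%R) / (z + INR (S m))).
Proof.
  intros Hz; unfold Gamma_seq.
  rewrite fact_simpl, mult_INR, RtoC_mult.
  change (rising z (S (S m))) with (rising z (S m) * (z + INR (S m))).
  replace (z * ln (INR (S m)))
    with (z * ln (INR m) + z * (ln (INR (S m)) - ln (INR m))%R)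
    by (rewrite RtoC_minus; ring).
  rewrite Cexp_plus. field; split.
  - apply not_Gamma_pole_add_neq_0, Hz.
  - apply rising_neq_0, Hz.
Qed.

Lemma Gamma_seq_neq_0 (z : C) (m : nat) : ~ Gamma_pole z -> Gamma_seq z m <> 0.
Proof.
  intros Hz; unfold Gamma_seq, Cdiv. repeat apply Cmult_neq_0.
  - intros H; apply RtoC_inj in H; revert H; apply INR_fact_neq_0.
  - apply Cexp_neq_0.
  - intros H; apply C1_nz.
    rewrite <- (Cinv_r _ (rising_neq_0 z (S m) Hz)), H; ring.
Qed.

(** Put h = ln(m+1) - ln m, so 1/(m+1) <= h <= 1/m. The ratio of consecutive terms minus 1 is
    ((m+1)(e^(zh) - 1 - zh) + z((m+1)h - 1)) / (z+m+1). The numerator is at most (6|z|^2 + |z|)/m,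
    and 2|z| <= m makes the denominator at least (m+1)/2 and |zh| <= 1/2. *)
Lemma Gamma_seq_increment (z : C) (m : nat) : ~ Gamma_pole z ->
  (0 < m)%nat -> (2 * Cmod z <= INR m)%R ->
  (Cmod (Gamma_seq z (S m) - Gamma_seq z m) <=
     (12 * Cmod z ^ 2 + 2 * Cmod z) * (/ INR m - / INR (S m)) * Cmod (Gamma_seq z m))%R.
Proof.
  intros Hz Hm Hzm. rewrite Gamma_seq_succ by assumption.
  set (g := Gamma_seq z m). set (h := (ln (INR (S m)) - ln (INR m))%R).
  assert (Hh1 : (h <= / INR m)%R) by (apply ln_succ_le; assumption).
  assert (Hh2 : (/ INR (S m) <= h)%R) by (apply ln_succ_ge; assumption).
  assert (Hd := not_Gamma_pole_add_neq_0 z (S m) Hz).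
  replace (g * (INR (S m) * Cexp (z * h) / (z + INR (S m))) - g)
    with ((INR (S m) * (Cexp (z * h) - (1 + z * h)) + z * (INR (S m) * h - 1)%R)
          / (z + INR (S m)) * g)
    by (rewrite RtoC_minus, RtoC_mult; field; assumption).
  rewrite Cmod_mult. apply Rmult_le_compat_r; [apply Cmod_ge_0|].
  rewrite Cmod_div by assumption.
  assert (HmS : INR (S m) = (INR m + 1)%R) by apply S_INR.
  assert (Hm1 : (1 <= INR m)%R) by (apply (le_INR 1); lia).
  assert (Hz0 := Cmod_ge_0 z).
  assert (HhS : (0 < / INR (S m))%R) by (apply Rinv_0_lt_compat; lra).
  assert (Hzh : Cmod (z * h) = (Cmod z * h)%R).
  { rewrite Cmod_mult, Cmod_R, Rabs_pos_eq by lra; reflexivity. }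
  assert (Hmm : (INR m * / INR m = 1)%R) by (apply Rinv_r; lra).
  assert (Hi : (0 < / INR m)%R) by (apply Rinv_0_lt_compat; lra).
  assert (Hsmall : (Cmod (z * h) <= / 2)%R).
  { rewrite Hzh. apply Rle_trans with (Cmod z * / INR m)%R.
    - apply Rmult_le_compat_l; assumption.
    - apply (Rmult_le_reg_r (INR m)); [lra|].
      rewrite Rmult_assoc, Rinv_l by lra. lra. }
  assert (T := Cexp_taylor1 _ Hsmall). rewrite Hzh in T.
  assert (Hden : (INR (S m) / 2 <= Cmod (z + INR (S m)))%R).
  { assert (X := Cmod_triangle (z + INR (S m)) (- z)).
    replace (z + INR (S m) + - z) with (RtoC (INR (S m))) in X by ring.
    rewrite Cmod_opp, Cmod_R, Rabs_pos_eq in X by lra. lra. }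
  assert (Hnum : (Cmod (INR (S m) * (Cexp (z * h) - (1 + z * h)) + z * (INR (S m) * h - 1)%R)
                  <= (6 * Cmod z ^ 2 + Cmod z) * / INR m)%R).
  { apply Rle_trans with (1 := Cmod_triangle _ _).
    rewrite !Cmod_mult, !Cmod_R.
    assert (HSh : (1 <= INR (S m) * h)%R).
    { apply (Rmult_le_compat_l (INR (S m))) in Hh2; [|lra].
      rewrite Rinv_r in Hh2 by lra. assumption. }
    rewrite !Rabs_pos_eq by lra.
    assert (A1 : (INR (S m) * h - 1 <= / INR m)%R).
    { apply (Rmult_le_compat_l (INR (S m))) in Hh1; [|lra].
      rewrite HmS in Hh1 at 2. rewrite HmS in *. lra. }
    assert (A2 : (INR (S m) * (3 * (Cmod z * h) ^ 2) <= 6 * Cmod z ^ 2 * / INR m)%R).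
    { assert (B1 : (h ^ 2 <= / INR m * / INR m)%R) by nra.
      assert (B2 : (INR (S m) * h ^ 2 <= 2 * / INR m)%R).
      { apply Rle_trans with (2 * INR m * (/ INR m * / INR m))%R.
        - apply Rmult_le_compat; try lra. apply pow2_ge_0.
        - apply Req_le; field; lra. }
      assert (B3 := pow2_ge_0 (Cmod z)). rewrite Rpow_mult_distr. nra. }
    apply (Rmult_le_compat_l (INR (S m))) in T; [|lra].
    apply (Rmult_le_compat_l (Cmod z)) in A1; [|lra]. lra. }
  apply Rle_trans with ((6 * Cmod z ^ 2 + Cmod z) * / INR m * / (INR (S m) / 2))%R.
  - apply Rmult_le_compat; try assumption.
    + apply Cmod_ge_0.
    + apply Rlt_le, Rinv_0_lt_compat; lra.
    + apply Rinv_le_contravar; lra.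
  - apply Req_le. rewrite HmS. field; lra.
Qed.

Lemma Gamma_seq_lim (z : C) : ~ Gamma_pole z ->
  exists l : C, l <> 0 /\ filterlim (Gamma_seq z) eventually (locally l).
Proof.
  intros Hz. destruct (INR_unbounded (2 * Cmod z)) as [N HN].
  apply (C_lim_of_relative_increments _ (12 * Cmod z ^ 2 + 2 * Cmod z) (S N)).
  - intros m; apply Gamma_seq_neq_0, Hz.
  - lia.
  - intros m Hm; apply Gamma_seq_increment; [assumption | lia|].
    assert (H := le_INR N m ltac:(lia)); lra.
Qed.

Lemma Gamma_neq_0 (z : C) : ~ Gamma_pole z -> Gamma z <> 0.
Proof.
  intros Hz; destruct (Gamma_seq_lim z Hz) as [l [Hl H]].
  rewrite (Gamma_lim _ _ H); assumption.
Qed.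

(** An exact finite form of the functional equation: the correction factor tends to 1, so passing to
    the limit gives [Gamma_succ]. *)
Lemma Gamma_seq_shift (z : C) (m : nat) : ~ Gamma_pole z ->
  Gamma_seq (z + 1) (S m) * (1 + (z + 1) * / INR (S m)) = z * Gamma_seq z (S m).
Proof.
  intros Hz. unfold Gamma_seq.
  assert (Hm := C_INR_S_neq_0 m).
  assert (Hz0 := not_Gamma_pole_neq_0 z Hz).
  assert (Hr : rising (z + 1) (S (S m)) = rising z (S (S m)) * (z + 1 + INR (S m)) / z).
  { transitivity (z * rising (z + 1) (S (S m)) / z); [field; assumption|].
    rewrite rising_shift. do 2 f_equal.
    change (rising z (S (S (S m)))) with (rising z (S (S m)) * (z + INR (S (S m)))).
    rewrite (C_INR_S (S m)). ring. }
  assert (Hr1 : z + 1 + INR (S m) <> 0).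
  { apply not_Gamma_pole_add_neq_0, not_Gamma_pole_succ, Hz. }
  assert (Hr2 := rising_neq_0 z (S (S m)) Hz).
  replace ((z + 1) * ln (INR (S m))) with (z * ln (INR (S m)) + ln (INR (S m))) by ring.
  rewrite Hr, Cexp_plus, Cexp_R, exp_ln by (apply lt_0_INR; lia).
  field; auto.
Qed.

Lemma Gamma_succ (z : C) : ~ Gamma_pole z -> Gamma (z + 1) = z * Gamma z.
Proof.
  intros Hz.
  destruct (Gamma_seq_lim z Hz) as [l [_ H]].
  destruct (Gamma_seq_lim (z + 1) (not_Gamma_pole_succ z Hz)) as [l' [_ H']].
  rewrite (Gamma_lim _ _ H), (Gamma_lim _ _ H').
  apply C_lim_unique with (fun m => z * Gamma_seq z (m + 1)%nat).
  - apply (filterlim_ext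
      (fun m => Gamma_seq (z + 1) (m + 1)%nat * (1 + (z + 1) * / INR (S m)))).
    { intros m; rewrite Nat.add_1_r; apply Gamma_seq_shift, Hz. }
    replace l' with (l' * (1 + (z + 1) * 0)) by ring.
    apply C_lim_mult; [apply (C_lim_incr_n (Gamma_seq (z + 1))); assumption|].
    apply C_lim_plus; [apply C_lim_const|].
    apply C_lim_mult; [apply C_lim_const | apply C_lim_inv_INR].
  - apply C_lim_mult; [apply C_lim_const|].
    apply (C_lim_incr_n (Gamma_seq z)); assumption.
Qed.

Lemma Gamma_rising (z : C) (k : nat) : ~ Gamma_pole z ->
  Gamma (z + INR k) = rising z k * Gamma z.
Proof.
  intros Hz; induction k as [|k IH].
  - simpl. rewrite Cplus_0_r. ring.
  - rewrite C_INR_S, Cplus_assoc, Gamma_succ, IH.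
    + simpl; ring.
    + intros H; apply Hz, (Gamma_pole_add z k), H.
Qed.

(** * Pochhammer symbols with complex index *)

Lemma poch_nat (z : C) (k : nat) : poch z (INR k) = rising z k.
Proof.
  unfold poch. change (Re (RtoC (INR k))) with (INR k).
  rewrite Int_part_INR, Nat2Z.id.
  destruct (Ceq_dec (INR k) (INR k)); [reflexivity | contradiction].
Qed.

(** Away from poles of the base, both branches of [poch] are the same Gamma quotient, so the shift
    rules below need no distinction between natural and other indices. *)
Lemma poch_Gamma (z x : C) : ~ Gamma_pole z -> poch_defined z x ->
  ~ Gamma_pole (z + x) /\ poch z x = Gamma (z + x) / Gamma z.
Proof.
  intros Hz Hx.
  assert (Hnat : forall k : nat, x = INR k ->
    ~ Gamma_pole (z + x) /\ poch z x = Gamma (z + x) / Gamma z).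
  { intros k ->; split.
    - intros H; apply Hz, (Gamma_pole_add z k), H.
    - rewrite poch_nat, Gamma_rising by assumption.
      field; apply Gamma_neq_0, Hz. }
  destruct Hx as [[k Hk] | [_ Hx]]; [eauto|].
  (* Avoiding the poles does not exclude a natural index, so the test inside [poch] still has to be
     decided. *)
  destruct (Ceq_dec x (INR (Z.to_nat (Int_part (Re x))))) as [E|E]; [eauto|].
  split; [assumption|]. unfold poch.
  destruct (Ceq_dec x (INR (Z.to_nat (Int_part (Re x))))); [contradiction | reflexivity].
Qed.

Lemma poch_succ (z x : C) : ~ Gamma_pole z ->
  poch_defined z x -> poch_defined z (x + 1) ->
  poch z (x + 1) = poch z x * (z + x).
Proof.
  intros Hz Hx Hx'.
  destruct (poch_Gamma z x Hz Hx) as [Hp ->], (poch_Gamma z _ Hz Hx') as [_ ->].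
  rewrite Cplus_assoc, Gamma_succ by assumption.
  field; apply Gamma_neq_0, Hz.
Qed.

Lemma poch_base_succ (z x : C) : ~ Gamma_pole z ->
  poch_defined z x -> poch (z + 1) x = poch z x * (z + x) / z.
Proof.
  intros Hz Hx. assert (Hz' := not_Gamma_pole_succ z Hz).
  destruct (poch_Gamma z x Hz Hx) as [Hp E].
  assert (Hx' : poch_defined (z + 1) x).
  { right; split; [assumption|].
    replace (z + 1 + x) with (z + x + 1) by ring. apply not_Gamma_pole_succ, Hp. }
  destruct (poch_Gamma (z + 1) x Hz' Hx') as [_ ->].
  rewrite E. replace (z + 1 + x) with (z + x + 1) by ring.
  rewrite !Gamma_succ by assumption.
  field; split; [apply Gamma_neq_0, Hz | apply not_Gamma_pole_neq_0, Hz].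
Qed.

(** * The telescoping relation *)

(** Through this factorisation the hypothesis on p2 yields 1 + 2 n <> 0 and a nonzero leading
    coefficient for the numerator of R in k. *)
Lemma p2_factor (a b c d n : C) :
  let e := a + d - b - c - 3 * n in
  p2 a b c d n = 4 * n * (1 + 2 * n) ^ 2 * (e * (e - 1) * (e + 1)).
Proof. intros e; unfold e, p2; ring. Qed.

(** This is the telescoping relation divided by F(n,k), with all denominators cleared. *)
Lemma wz_polynomial_identity (a b c d n k : C) :
  p1 a b c d n * (4 * n * (1 + 2 * n) ^ 2) * (n + (k + d)) +
  p2 a b c d n * ((2 * n + (k + b)) * (2 * n + (k + c)) *
                  (2 * n + 1 + (k + b)) * (2 * n + 1 + (k + c))) =
  4 * n * (1 + 2 * n) ^ 2 *
    (Rnum a b c d n (k + 1) * (a + k) * (n + (k + d)) -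
     Rnum a b c d n k * (2 * n + 1 + (k + b)) * (2 * n + 1 + (k + c))).
Proof. unfold p1, p2, Rnum; ring. Qed.

Lemma Rnum_cubic (a b c d n : C) :
  let e := a + d - b - c - 3 * n in
  exists q0 q1 q2 : C, forall k : C,
    Rnum a b c d n k = q0 + q1 * k + q2 * k ^ 2 + e * (e - 1) * k ^ 3.
Proof.
  intros e. set (P := Rnum a b c d n).
  (* Interpolation at 0, 1 and -1 recovers the lower coefficients once the cubic one is known; only
     the latter matters later. *)
  exists (P 0), ((P 1 - P (- (1))) / 2 - e * (e - 1)),
    ((P 1 + P (- (1))) / 2 - P 0).
  intros k; unfold P, e, Rnum. field.
Qed.

(** If z = -m, definedness at k = 0 forces x to be a natural number; then at k = m + 1 the rising
    factorial contains the factor z + m = 0, and the denominator vanishes. *)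
Lemma base_not_pole (z x y : C) :
  (forall k : nat, poch_defined z (INR k + x)) ->
  (forall k : nat, poch z (INR k + x) * poch z (INR k + y) <> 0) ->
  ~ Gamma_pole z.
Proof.
  intros Hdef Hne [m Hm].
  assert (Hnat : exists j : nat, x = INR j).
  { destruct (Hdef 0%nat) as [[j Hj] | [H _]].
    - exists j. rewrite <- Hj; simpl; ring.
    - exfalso; apply H; exists m; assumption. }
  destruct Hnat as [j ->].
  apply (Hne (S m)). rewrite <- RtoC_plus, <- plus_INR, poch_nat, Hm, rising_pole by lia.
  ring.
Qed.

Lemma double_not_pole (a b c d n : C) :
  (forall k : nat, F_defined a b c d n k) -> ~ Gamma_pole (2 * n).
Proof.
  intros hF.
  apply (base_not_pole (2 * n) c b); intros k; apply (hF k).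
Qed.

Lemma not_pole_of_double (n : C) : ~ Gamma_pole (2 * n) -> ~ Gamma_pole n.
Proof.
  intros H2 [m Hm]; apply H2; exists (m + m)%nat.
  rewrite Hm, plus_INR, RtoC_plus; ring.
Qed.

Lemma F_succ (a b c d n : C) (hF : forall k : nat, F_defined a b c d n k) (k : nat) :
  (2 * n + (INR k + b)) * (2 * n + (INR k + c)) * F a b c d n (S k) =
  F a b c d n k * ((a + INR k) * (n + (INR k + d))).
Proof.
  destruct (hF k) as (_ & Dn & Dc & Db & N).
  destruct (hF (S k)) as (_ & Dn' & Dc' & Db' & N').
  assert (H2 := double_not_pole _ _ _ _ _ hF).
  unfold F. rewrite !poch_nat. simpl rising.
  rewrite C_INR_S in *.
  replace (INR k + 1 + d) with (INR k + d + 1) in * by ring.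
  replace (INR k + 1 + c) with (INR k + c + 1) in * by ring.
  replace (INR k + 1 + b) with (INR k + b + 1) in * by ring.
  rewrite (poch_succ _ _ H2 Dc Dc'),
    (poch_succ _ _ H2 Db Db') in *.
  rewrite (poch_succ _ _ (not_pole_of_double _ H2) Dn Dn').
  set (pc := poch (2 * n) (INR k + c)) in *.
  set (pb := poch (2 * n) (INR k + b)) in *.
  (* After the rewriting, every factor that must be nonzero divides the denominator of F(n,k+1),
     which [N'] keeps from vanishing. *)
  field; repeat split; intros E; apply N'; rewrite E; ring.
Qed.

(** The base n moves by one unit step and each base 2 n by two. The factors free of k collect to
    (2n)^2 (2n+1)^2 / n = 4 n (1+2n)^2. *)
Lemma F_base_succ (a b c d n : C) (hF : forall k : nat, F_defined a b c d n k)
  (k : nat) : 1 + 2 * n <> 0 ->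
  (2 * n + (INR k + b)) * (2 * n + (INR k + c)) *
  (2 * n + 1 + (INR k + b)) * (2 * n + 1 + (INR k + c)) * F a b c d (n + 1) k =
  F a b c d n k * (4 * n * (1 + 2 * n) ^ 2 * (n + (INR k + d))).
Proof.
  intros Hn1.
  destruct (hF k) as (_ & Dn & Dc & Db & N).
  assert (H2 := double_not_pole _ _ _ _ _ hF). assert (H1 := not_pole_of_double _ H2).
  assert (H21 := not_Gamma_pole_succ _ H2).
  destruct (poch_Gamma _ _ H2 Dc) as [Hc _].
  destruct (poch_Gamma _ _ H2 Db) as [Hb _].
  assert (Hcs := not_Gamma_pole_succ _ Hc). assert (Hbs := not_Gamma_pole_succ _ Hb).
  assert (Hdef : forall x, ~ Gamma_pole (2 * n + x) -> poch_defined (2 * n + 1) x).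
  { intros x Hx; right; split; [assumption|].
    replace (2 * n + 1 + x) with (2 * n + x + 1) by ring.
    apply not_Gamma_pole_succ, Hx. }
  unfold F. replace (2 * (n + 1)) with (2 * n + 1 + 1) by ring.
  rewrite (poch_base_succ _ _ H1 Dn).
  rewrite !(poch_base_succ (2 * n + 1)) by auto.
  rewrite !(poch_base_succ (2 * n)) by assumption.
  apply not_Gamma_pole_neq_0 in H1, Hc, Hb, Hcs, Hbs.
  set (pc := poch (2 * n) (INR k + c)) in *.
  set (pb := poch (2 * n) (INR k + b)) in *.
  replace (2 * n + (INR k + c) + 1) with (2 * n + 1 + (INR k + c)) in Hcs by ring.
  replace (2 * n + (INR k + b) + 1) with (2 * n + 1 + (INR k + b)) in Hbs by ring.
  assert (Hpc : pc <> 0) by (intros E; apply N; rewrite E; ring).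
  assert (Hpb : pb <> 0) by (intros E; apply N; rewrite E; ring).
  rewrite Cplus_comm in Hn1.
  field; repeat split; assumption.
Qed.

Lemma G_telescoping (a b c d n : C) (hF : forall k : nat, F_defined a b c d n k)
  (k : nat) : 1 + 2 * n <> 0 ->
  p1 a b c d n * F a b c d (n + 1) k + p2 a b c d n * F a b c d n k =
  G a b c d n (S k) - G a b c d n k.
Proof.
  intros Hn1.
  destruct (hF k) as (_ & Dn & Dc & Db & N).
  assert (H2 := double_not_pole _ _ _ _ _ hF).
  destruct (poch_Gamma _ _ H2 Dc) as [Hc _].
  destruct (poch_Gamma _ _ H2 Db) as [Hb _].
  assert (Hcs := not_Gamma_pole_succ _ Hc). assert (Hbs := not_Gamma_pole_succ _ Hb).
  apply not_Gamma_pole_neq_0 in Hc, Hb, Hcs, Hbs.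
  replace (2 * n + (INR k + c) + 1) with (2 * n + 1 + (INR k + c)) in Hcs by ring.
  replace (2 * n + (INR k + b) + 1) with (2 * n + 1 + (INR k + b)) in Hbs by ring.
  assert (E1 := F_base_succ _ _ _ _ _ hF k Hn1).
  assert (E2 := F_succ _ _ _ _ _ hF k).
  assert (W := wz_polynomial_identity a b c d n (INR k)).
  unfold G, Rfun, Rden. rewrite C_INR_S.
  (* The linear factors and the polynomials become atoms for [field]; their content enters only
     through [W]. *)
  set (A := 2 * n + (INR k + b)) in *. set (B := 2 * n + (INR k + c)) in *.
  set (A' := 2 * n + 1 + (INR k + b)) in *. set (B' := 2 * n + 1 + (INR k + c)) in *.
  replace (b + INR k + 2 * n) with A by (unfold A; ring).
  replace (c + INR k + 2 * n) with B by (unfold B; ring).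
  replace (b + (INR k + 1) + 2 * n) with A' by (unfold A'; ring).
  replace (c + (INR k + 1) + 2 * n) with B' by (unfold B'; ring).
  set (r := Rnum a b c d n (INR k)) in *.
  set (r' := Rnum a b c d n (INR k + 1)) in *.
  set (q1 := p1 a b c d n) in *. set (q2 := p2 a b c d n) in *.
  set (f := F a b c d n k) in *.
  assert (F1 : F a b c d (n + 1) k
               = f * (4 * n * (1 + 2 * n) ^ 2 * (n + (INR k + d))) / (A * B * A' * B')).
  { rewrite <- E1. field; repeat split; assumption. }
  assert (F2 : F a b c d n (S k) = f * ((a + INR k) * (n + (INR k + d))) / (A * B)).
  { rewrite <- E2. field; repeat split; assumption. }
  rewrite F1, F2.
  transitivity (f / (A * B * A' * B') *
    (q1 * (4 * n * (1 + 2 * n) ^ 2) * (n + (INR k + d)) + q2 * (A * B * A' * B'))).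
  { field; repeat split; assumption. }
  rewrite W. field; repeat split; assumption.
Qed.

(** * Vanishing of the limit of G *)

Lemma C_lim_cancel_r (u v : nat -> C) (l r : C) : r <> 0 ->
  filterlim (fun m => u m * v m) eventually (locally l) ->
  filterlim v eventually (locally r) ->
  filterlim u eventually (locally (l / r)).
Proof.
  intros Hr Huv Hv.
  apply (filterlim_ext_loc (fun m => u m * v m * / v m)).
  (* The quotient v(m)/r tends to 1, so its real part is eventually within distance less than 1 of
     1, which rules out v(m) = 0. *)
  - assert (H : filterlim (fun m => v m * / r) eventually (locally (r * / r)))
      by (apply C_lim_mult; [assumption | apply C_lim_const]).
    rewrite Cinv_r, filterlim_C in H by assumption.
    destruct H as [H _]. apply is_lim_seq_spec in H.
    generalize (H (mkposreal 1 Rlt_0_1)); apply filter_imp.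
    intros m Hm. assert (v m <> 0); [|field; assumption].
    intros E; rewrite E, Cmult_0_l in Hm; simpl in Hm.
    rewrite Rabs_minus_sym, Rabs_pos_eq in Hm; lra.
  - apply C_lim_mult; [assumption | apply C_lim_inv; assumption].
Qed.

Ltac C_lim_arith :=
  repeat match goal with
  | |- filterlim (fun _ => ?c) _ _ => apply (C_lim_const c)
  | |- filterlim (fun m => @?u m + @?v m) _ _ => apply (C_lim_plus u v)
  | |- filterlim (fun m => @?u m * @?v m) _ _ => apply (C_lim_mult u v)
  end.

Lemma lim_G_eq_0 (a b c d n L : C) :
  let e := a + d - b - c - 3 * n in
  4 * n * (1 + 2 * n) ^ 2 * (e * (e - 1)) <> 0 ->
  (forall k : nat, Rfun_defined b c n (INR k)) ->
  ex_series (F a b c d n) ->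
  filterlim (G a b c d n) eventually (locally L) -> L = 0.
Proof.
  intros e Hlead hR Hser HG.
  set (r := 4 * n * (1 + 2 * n) ^ 2 * (e * (e - 1))) in *.
  destruct (Rnum_cubic a b c d n) as (q0 & q1 & q2 & Hq). fold e in Hq.
  assert (Hlim : filterlim (fun m => INR m * F a b c d n m) eventually (locally (L / r))).
  { apply (C_lim_incr_n _ 1).
    set (t m := / INR (S m)).
    assert (Ht := C_lim_inv_INR).
    change (filterlim t eventually (locally (RtoC 0))) in Ht.
    (* With k = m + 1 and t = 1/k, the factor [v] is 4 n (1+2n)^2 Rnum(k)/k^3; its limit is [r]. *)
    apply C_lim_cancel_r with
      (v := fun m => 4 * n * (1 + 2 * n) ^ 2 *
              (q0 * (t m * (t m * t m)) + q1 * (t m * t m) + q2 * t m + e * (e - 1)));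
      [assumption| |].
    (* The factor next to G is Rden(k)/k^2, which tends to 1. *)
    - apply (filterlim_ext (fun m => G a b c d n (m + 1) *
               ((b * t m + 1 + 2 * n * t m) * (c * t m + 1 + 2 * n * t m)))).
      { intros m; rewrite Nat.add_1_r. unfold G, Rfun.
        assert (Hd := hR (S m)); unfold Rfun_defined, Rden in *.
        assert (Hm := C_INR_S_neq_0 m).
        rewrite Hq; unfold t. field.
        split; [assumption | split; intros E; apply Hd; rewrite E; ring]. }
      replace L with (L * ((b * 0 + 1 + 2 * n * 0) * (c * 0 + 1 + 2 * n * 0))) by ring.
      apply C_lim_mult; [apply (C_lim_incr_n (G a b c d n)); assumption|].
      C_lim_arith; exact Ht.
    - replace r with (4 * n * (1 + 2 * n) ^ 2 *
        (q0 * (0 * (0 * 0)) + q1 * (0 * 0) + q2 * 0 + e * (e - 1))) by (unfold r; ring).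
      C_lim_arith; exact Ht. }
  apply C_ex_series_lim_INR_mult in Hlim; [|assumption].
  replace L with (L / r * r) by (field; assumption).
  rewrite Hlim; ring.
Qed.

Theorem theorem3 (a b c d n : C)
  (hF : forall k : nat, F_defined a b c d n k)
  (hF1 : forall k : nat, F_defined a b c d (n + 1)%C k)
  (hR : forall k : nat, Rfun_defined b c n (RtoC (INR k)))
  (hconv : ex_series (F a b c d n))
  (hconv1 : ex_series (F a b c d (n + 1)%C))
  (hp2 : p2 a b c d n <> RtoC 0) :
  calF a b c d n =
    (g1 a b c d n + g2 a b c d n * calF a b c d (n + 1))%C.
Proof.
  set (e := a + d - b - c - 3 * n).
  assert (Hlead : 4 * n * (1 + 2 * n) ^ 2 * (e * (e - 1)) <> 0).
  { intros E; apply hp2. rewrite p2_factor. fold e.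
    transitivity (4 * n * (1 + 2 * n) ^ 2 * (e * (e - 1)) * (e + 1)); [ring|].
    rewrite E; ring. }
  assert (Hn1 : 1 + 2 * n <> 0).
  { intros E; apply Hlead; rewrite E; ring. }
  assert (Hs : exists s : C, is_series (F a b c d n) s) by exact hconv.
  assert (Hs1 : exists s : C, is_series (F a b c d (n + 1)) s) by exact hconv1.
  destruct Hs as [s Hs], Hs1 as [s1 Hs1].
  rewrite (calF_series _ _ _ _ _ _ Hs), (calF_series _ _ _ _ _ _ Hs1).
  (* Summing the telescoping relation over 0..m expresses G(n,m+1) by partial sums of the two
     convergent series, so G(n,k) converges. *)
  assert (HG : filterlim (G a b c d n) eventually
                 (locally (p1 a b c d n * s1 + p2 a b c d n * s + G a b c d n 0))).
  { apply (C_lim_incr_n _ 1).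
    apply (filterlim_ext (fun m => p1 a b c d n * sum_n (F a b c d (n + 1)) m +
             p2 a b c d n * sum_n (F a b c d n) m + G a b c d n 0)).
    - intros m; induction m as [|m IH]; rewrite Nat.add_1_r in *.
      + rewrite !sum_O, (G_telescoping _ _ _ _ _ hF) by assumption. ring.
      + replace (G a b c d n (S (S m)))
          with (G a b c d n (S (S m)) - G a b c d n (S m) + G a b c d n (S m)) by ring.
        rewrite <- (G_telescoping _ _ _ _ _ hF), <- IH, !sum_Sn by assumption.
        change (@plus _) with Cplus. ring.
    - repeat apply C_lim_plus; try apply C_lim_mult; try apply C_lim_const.
      + exact Hs1.
      + exact Hs. }
  apply lim_G_eq_0 in HG; try assumption.
  unfold g1, g2.
  (* The numerator of the first fraction is the limit of G, now known to be 0; the other two terms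
     are [g1] and [g2] times the second sum. *)
  transitivity ((p1 a b c d n * s1 + p2 a b c d n * s + G a b c d n 0) / p2 a b c d n
    - G a b c d n 0 / p2 a b c d n - p1 a b c d n / p2 a b c d n * s1).
  - field; assumption.
  - rewrite HG; field; assumption.
Qed.
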